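(* Let $R$, $I$, $(F_\bullet,d_\bullet)$, $F_1'$, $e_0^1,\dots,e_0^t$, $\mathfrak a_i$, $(G^i_\bullet,m^i_\bullet)$, $q^i_1,q^i_2$ and the iterated trimming complex $(T_\bullet,\ell_\bullet)$ be as in the context, and assume that $F_\bullet$ and $G^i_\bullet$ ($1\le i\le t$) are length $3$ DG-algebras. Then $(T_\bullet,\ell_\bullet)$ admits the structure of an associative DG-algebra whose product $\cdot_T$ has the following form. For an element $z$ of $T_n=F_n\oplus\bigoplus_{k}G^k_n$ ($n=2,3$) let $[z]_F\in F_n$ and $[z]_k\in G^k_n$ denote its components; $\delta$ is the Kronecker delta; $f_1,f_1'\in F_1'$, $f_2\in F_2$, $g_1^i,{g'}_1^i\in G_1^i$, $g_2^i\in G_2^i$ are arbitrary, and $1\le i,j,k\le t$. Product $T_1\otimes T_1\to T_2$: (1) $[f_1\cdot_T f_1']_F=f_1\cdot_F f_1'$ and $m_2^k([f_1\cdot_T f_1']_k)=q_1^k(f_1\cdot_F f_1')$. (2) $[f_1\cdot_T g_1^i]_F=m_1^i(g_1^i)\,e_0^i\cdot_F f_1$ and $m_2^k([f_1\cdot_T g_1^i]_k)=\delta_{ik}\,d_1(f_1)g_1^i+m_1^i(g_1^i)\,q_1^k(e_0^i\cdot_F f_1)$. (3) $g_1^i\cdot_T {g'}_1^i=-d_1(e_0^i)\; g_1^i\cdot_{G^i}{g'}_1^i\in G_2^i$. (4) For $i<j$: $[g_1^i\cdot_T g_1^j]_F=m_1^i(g_1^i)m_1^j(g_1^j)\,e_0^i\cdot_F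 e_0^j$ and $$m_2^k([g_1^i\cdot_T g_1^j]_k)=m_1^i(g_1^i)m_1^j(g_1^j)\,q_1^k(e_0^i\cdot_F e_0^j)+\delta_{ki}\,m_1^j(g_1^j)d_1(e_0^j)g_1^i-\delta_{kj}\,m_1^i(g_1^i)d_1(e_0^i)g_1^j .$$ Product $T_1\otimes T_2\to T_3$: (5) $[f_1\cdot_T f_2]_F=f_1\cdot_F f_2$ and $$m_3^k([f_1\cdot_T f_2]_k)=-\Big([f_1\cdot_T d_2'(f_2)]_k-\sum_{j=1}^t[f_1\cdot_T q_1^j(f_2)]_k+q_2^k(f_1\cdot_F f_2)\Big).$$ (6) $[f_1\cdot_T g_2^i]_F=0$ and $m_3^k([f_1\cdot_T g_2^i]_k)=\delta_{ik}\,d_1(f_1)g_2^i-[f_1\cdot_T m_2^i(g_2^i)]_k$. (7) $g_1^i\cdot_T g_2^i=-d_1(e_0^i)\;g_1^i\cdot_{G^i}g_2^i\in G_3^i$. (8) For $i\ne j$: $[g_1^i\cdot_T g_2^j]_F=0$ and $m_3^k([g_1^i\cdot_T g_2^j]_k)=-[g_1^i\cdot_T m_2^j(g_2^j)]_k-\delta_{kj}\,m_1^i(g_1^i)d_1(e_0^i)g_2^j$. (9) $[g_1^i\cdot_T f_2]_F=-m_1^i(g_1^i)\,e_0^i\cdot_F f_2$ and $$m_3^k([g_1^i\cdot_T f_2]_k)=-\delta_{ik}\,d_1(e_0^i)\;g_1^i\cdot_{G^i}q_1^i(f_2)+[d_2'(f_2)\cdot_T g_1^i]_k+\sum_{l\ne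 i}[g_1^i\cdot_T q_1^l(f_2)]_k+m_1^i(g_1^i)\,q_2^k(e_0^i\cdot_F f_2).$$
   Context: A DG-algebra over a commutative Noetherian ring $R$ is a complex of finitely generated free $R$-modules $(F_\bullet,d_\bullet)$ with a unitary associative multiplication satisfying $F_i\cdot F_j\subseteq F_{i+j}$, $d(f_if_j)=d(f_i)f_j+(-1)^if_id(f_j)$, $f_if_j=(-1)^{ij}f_jf_i$, and $f_i^2=0$ for $i$ odd (where $f_i\in F_i$). The product of a DG-algebra $F_\bullet$ is written $\cdot_F$. Setting. $(R,\mathfrak m,k)$ is a regular local ring (alternatively, a standard graded polynomial ring over a field $k$ with all data homogeneous). $I\subseteq R$ is an ideal and $(F_\bullet,d_\bullet)$ is a free resolution of $R/I$ with $F_0=R$ (not necessarily minimal). Write $F_1=F_1'\oplus\bigoplus_{i=1}^tRe_0^i$, where each $e_0^i$ generates a free direct summand, and decompose $d_2=d_2'+d_0^1+\dots+d_0^t$ with $d_2'\in\operatorname{Hom}_R(F_2,F_1')$ and $d_0^i\in\operatorname{Hom}_R(F_2,Re_0^i)$. For each $i$ let $\mathfrak a_i$ be an ideal with $d_0^i(F_2)\subseteq\mathfrak a_ie_0^i$ and $(G^i_\bullet,m^i_\bullet)$ a free resolution of $R/\mathfrak a_i$ with $G_0^i=R$. All of $F_\bullet,G^i_\bullet$ have length $3$. Let $q_1^i:F_2\to G_1^i$ and $q_2^i:F_3\to G_2^i$ be maps with $m_1^i(q_1^i(f_2))\,e_0^i=d_0^i(f_2)$ and $m_2^i\circ q_2^i=q_1^i\circ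 d_3$ (such maps exist). The iterated trimming complex $T_\bullet$ is the complex with $T_0=R$, $T_1=F_1'\oplus\bigoplus_iG_1^i$, $T_2=F_2\oplus\bigoplus_iG_2^i$, $T_3=F_3\oplus\bigoplus_iG_3^i$ (elements of direct sums are written as sums) and differentials $\ell_1(f_1+\sum g_1^i)=d_1(f_1)-\sum_i m_1^i(g_1^i)d_1(e_0^i)$, $\ell_2(f_2+\sum g_2^i)=d_2'(f_2)-\sum_iq_1^i(f_2)+\sum_im_2^i(g_2^i)$, $\ell_3(f_3+\sum g_3^i)=d_3(f_3)+\sum_iq_2^i(f_3)+\sum_im_3^i(g_3^i)$. It is known that $T_\bullet$ is a free resolution of $R/J$, where $J=d_1(F_1')+\sum_i\mathfrak a_i\,d_1(e_0^i)$. *)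

(* Defs.v *)
From HB Require Import structures.
From mathcomp Require Import all_boot all_order all_algebra.
From mathcomp Require Import mpoly.

Set Implicit Arguments.
Unset Strict Implicit.
Unset Printing Implicit Defensive.

Import GRing.Theory.
Local Open Scope ring_scope.

(** * Regular local rings *)

Section RegularLocal.
Variable R : comNzRingType.
Implicit Types I J P : R -> Prop.

Definition ideal I := I 0 /\ forall a x y, I x -> I y -> I (a * x + y).

Definition ideal_le I J := forall x, I x -> J x.

Definition generates n (s : 'I_n -> R) I :=
  forall x, I x <-> exists c : 'I_n -> R, x = \sum_i c i * s i.

Definition noetherian :=
  forall I, ideal I -> exists n (s : 'I_n -> R), generates s I.

Definition prime_ideal P :=
  [/\ ideal P, ~ P 1 & forall x y, P (x * y) -> P x \/ P y].

Definition maximal_ideal I :=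
  [/\ ideal I, ~ I 1
    & forall J, ideal J -> ~ J 1 -> ideal_le I J -> ideal_le J I].

Definition prime_chain n (Q : 'I_n.+1 -> R -> Prop) :=
  (forall i, prime_ideal (Q i)) /\
  (forall i j : 'I_n.+1, (i < j)%N -> ideal_le (Q i) (Q j) /\ ~ ideal_le (Q j) (Q i)).

Definition krull_dim n :=
  (exists Q, @prime_chain n Q) /\
  (forall m Q, @prime_chain m Q -> (m <= n)%N).

Definition regular_local :=
  noetherian /\
  exists mm, [/\ maximal_ideal mm,
                 forall I, maximal_ideal I -> forall x, I x <-> mm x
               & exists n (s : 'I_n -> R), krull_dim n /\ generates s mm].

End RegularLocal.

(** * Finite direct sums of finitely generated free modules *)

(* [vectType R] is the type of finitely generated free [R]-modules.  MathComp
   has no direct sum of a dependent family of them, so it is built here. *)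
Section DirectSum.
Variables (R : nzRingType) (t : nat) (V : 'I_t -> vectType R).

Definition dsum := {dffun forall i : 'I_t, V i}.

HB.instance Definition _ := Choice.on dsum.

Implicit Types u v w : dsum.

Definition dsum_of (f : forall i, V i) : dsum := [ffun i => f i].

Lemma dsumE f i : dsum_of f i = f i. Proof. by rewrite ffunE. Qed.

Lemma dsumP u v : (forall i, u i = v i) <-> u = v.
Proof. by split=> [/ffunP|->]. Qed.

Definition dsum0 := dsum_of (fun i => 0).
Definition dsum_opp u := dsum_of (fun i => - u i).
Definition dsum_add u v := dsum_of (fun i => u i + v i).
Definition dsum_scale a u := dsum_of (fun i => a *: u i).

Fact dsum_addA : associative dsum_add.
Proof. by move=> u v w; apply/dsumP=> i; rewrite !dsumE addrA. Qed.
Fact dsum_addC : commutative dsum_add.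
Proof. by move=> u v; apply/dsumP=> i; rewrite !dsumE addrC. Qed.
Fact dsum_add0 : left_id dsum0 dsum_add.
Proof. by move=> u; apply/dsumP=> i; rewrite !dsumE add0r. Qed.
Fact dsum_addN : left_inverse dsum0 dsum_opp dsum_add.
Proof. by move=> u; apply/dsumP=> i; rewrite !dsumE addNr. Qed.

HB.instance Definition _ :=
  GRing.isZmodule.Build dsum dsum_addA dsum_addC dsum_add0 dsum_addN.

Fact dsum_scaleA a b u : dsum_scale a (dsum_scale b u) = dsum_scale (a * b) u.
Proof. by apply/dsumP=> i; rewrite !dsumE scalerA. Qed.
Fact dsum_scale1 : left_id 1 dsum_scale.
Proof. by move=> u; apply/dsumP=> i; rewrite !dsumE scale1r. Qed.
Fact dsum_scaleDr : right_distributive dsum_scale +%R.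
Proof. by move=> a u v; apply/dsumP=> i; rewrite !dsumE scalerDr. Qed.
Fact dsum_scaleDl u : {morph dsum_scale^~ u : a b / a + b}.
Proof. by move=> a b; apply/dsumP=> i; rewrite !dsumE scalerDl. Qed.

HB.instance Definition _ := GRing.Zmodule_isLmodule.Build R dsum
  dsum_scaleA dsum_scale1 dsum_scaleDr dsum_scaleDl.

Lemma dsum0E i : (0 : dsum) i = 0. Proof. exact: dsumE. Qed.
Lemma dsumNE u i : (- u) i = - u i. Proof. exact: dsumE. Qed.
Lemma dsumDE u v i : (u + v) i = u i + v i. Proof. exact: dsumE. Qed.
Lemma dsumZE a u i : (a *: u) i = a *: u i. Proof. exact: dsumE. Qed.

Fact dsum_vect_iso : Vector.axiom (\sum_i dim (V i)) dsum.
Proof.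
pose f u : 'rV[R]_(\sum_i dim (V i)) :=
  \mxrow_i VectorInternalTheory.v2r (u i).
exists f.
- move=> a u v; apply/rowP=> j.
  rewrite !mxE dsumDE dsumZE; set k := tagnat.sig1 j.
  have [hZ hD] := v2r_semilinear (VectorInternalTheory.v2r_subproof (V k)).
  by rewrite /VectorInternalTheory.v2r hD hZ !mxE.
- exists (fun r => dsum_of (fun i => VectorInternalTheory.r2v (submxrow r i))).
    move=> u; apply/dsumP=> i.
    by rewrite dsumE mxrowK VectorInternalTheory.v2rK.
  move=> r; rewrite /f -[RHS]submxrowK; apply: eq_mxrow=> i.
  by rewrite dsumE VectorInternalTheory.r2vK.
Qed.

HB.instance Definition _ := Lmodule_hasFinDim.Build R dsum dsum_vect_iso.

(* [dinj i x k] is [x] if [k = i] and [0] otherwise. *)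
Definition dinj i (x : V i) : dsum := dsum_of (dfwith (fun k => 0 : V k) x).

End DirectSum.

(** * DG-algebras *)

Section DGAlgebra.
Variable R : comNzRingType.

(* The degree of a product is an index [n] with a proof of [i + j = n], so that
   the two sides of each axiom below live in the same module. *)
Definition product (F : nat -> vectType R) :=
  forall i j n, (i + j)%N = n -> F i -> F j -> F n.

Record dg_algebra (F : nat -> vectType R)
    (d : forall n, {linear F n.+1 -> F n}) (one : F 0%N)
    (mul : product F) : Prop := DGAlgebra {
  dg_diffK : forall n (x : F n.+2), d n (d n.+1 x) = 0;
  dg_linearl : forall i j n (H : (i + j)%N = n) (y : F j),
    linear (fun x : F i => mul i j n H x y);
  dg_linearr : forall i j n (H : (i + j)%N = n) (x : F i),
    linear (fun y : F j => mul i j n H x y);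
  dg_mul1l : forall n (H : (0 + n)%N = n) (x : F n), mul 0%N n n H one x = x;
  dg_mulr1 : forall n (H : (n + 0)%N = n) (x : F n), mul n 0%N n H x one = x;
  dg_assoc : forall i j k a b n (Ha : (i + j)%N = a) (Hak : (a + k)%N = n)
      (Hb : (j + k)%N = b) (Hib : (i + b)%N = n)
      (x : F i) (y : F j) (z : F k),
    mul a k n Hak (mul i j a Ha x y) z = mul i b n Hib x (mul j k b Hb y z);
  dg_leibniz : forall i j n (H : (i.+1 + j.+1)%N = n.+1)
      (Hl : (i + j.+1)%N = n) (Hr : (i.+1 + j)%N = n)
      (x : F i.+1) (y : F j.+1),
    d n (mul i.+1 j.+1 n.+1 H x y)
    = mul i j.+1 n Hl (d i x) y + (-1) ^+ i.+1 *: mul i.+1 j n Hr x (d j y);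
  dg_leibniz0l : forall j n (H : (0 + j.+1)%N = n.+1) (Hr : (0 + j)%N = n)
      (x : F 0%N) (y : F j.+1),
    d n (mul 0%N j.+1 n.+1 H x y) = mul 0%N j n Hr x (d j y);
  dg_leibniz0r : forall i n (H : (i.+1 + 0)%N = n.+1) (Hl : (i + 0)%N = n)
      (x : F i.+1) (y : F 0%N),
    d n (mul i.+1 0%N n.+1 H x y) = mul i 0%N n Hl (d i x) y;
  dg_comm : forall i j n (H : (i + j)%N = n) (H' : (j + i)%N = n)
      (x : F i) (y : F j),
    mul i j n H x y = (-1) ^+ (i * j) *: mul j i n H' y x;
  dg_sqr : forall i n (H : (i + i)%N = n) (x : F i),
    odd i -> mul i i n H x x = 0
}.

(* Maps [0 -> M3 -> M2 -> M1 -> R] between finitely generated free modules;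
   that they form a complex is part of [resolution3] and [dg_algebra]. *)
Record free3 := Free3 {
  M1 : vectType R;
  M2 : vectType R;
  M3 : vectType R;
  dif1 : {linear M1 -> R^o};
  dif2 : {linear M2 -> M1};
  dif3 : {linear M3 -> M2}
}.

Definition term (C : free3) (n : nat) : vectType R :=
  match n with
  | 0 => R^o
  | 1 => M1 C
  | 2 => M2 C
  | 3 => M3 C
  | _ => 'rV[R]_0
  end.

Definition diff (C : free3) (n : nat) : {linear term C n.+1 -> term C n} :=
  match n return {linear term C n.+1 -> term C n} with
  | 0 => dif1 C
  | 1 => dif2 C
  | 2 => dif3 C
  | _ => \0
  end.

Definition dg_algebra3 (C : free3) (mul : product (term C)) :=
  dg_algebra (diff C) (1 : R^o) mul.

Definition resolution3 (C : free3) (I : R -> Prop) :=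
  [/\ forall r, I r <-> exists x, dif1 C x = r,
      forall x, dif1 C x = 0 <-> exists y, dif2 C y = x,
      forall y, dif2 C y = 0 <-> exists z, dif3 C z = y
    & injective (dif3 C)].

Definition mul11 (C : free3) (mul : product (term C)) (x y : M1 C) : M2 C :=
  mul 1%N 1%N 2%N erefl x y.

Definition mul12 (C : free3) (mul : product (term C))
    (x : M1 C) (y : M2 C) : M3 C :=
  mul 1%N 2%N 3%N erefl x y.

End DGAlgebra.

(** * Iterated trimming complexes *)

Section Trimming.
Variables (R : comNzRingType) (t : nat).

(* The decomposition [F_1 = F_1' (+) R e_0^1 (+) ... (+) R e_0^t] is given by
   the inclusion [inc] of [F_1'], the elements [e0 i], the projection [pr] onto
   [F_1'] and the coordinate forms [co i].  As a direct summand of a finitely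
   generated free module over [R], [F_1'] is free. *)
Record trimming_data := TrimmingData {
  idI : R -> Prop;
  idI_ideal : ideal idI;
  resF : free3 R;
  resFP : resolution3 resF idI;
  F1' : vectType R;
  inc : {linear F1' -> M1 resF};
  e0 : 'I_t -> M1 resF;
  pr : {linear M1 resF -> F1'};
  co : forall i : 'I_t, {linear M1 resF -> R^o};
  pr_inc : forall f, pr (inc f) = f;
  pr_e0 : forall i, pr (e0 i) = 0;
  co_inc : forall i f, co i (inc f) = 0;
  co_e0 : forall i j, co i (e0 j) = (i == j)%:R;
  decF1 : forall x, x = inc (pr x) + \sum_i co i x *: e0 i;
  ida : 'I_t -> R -> Prop;
  ida_ideal : forall i, ideal (ida i);
  ida_d0 : forall i (f2 : M2 resF),
    exists2 a, ida i a & co i (dif2 resF f2) *: e0 i = a *: e0 i;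
  resG : 'I_t -> free3 R;
  resGP : forall i, resolution3 (resG i) (ida i);
  q1 : forall i, {linear M2 resF -> M1 (resG i)};
  q2 : forall i, {linear M3 resF -> M2 (resG i)};
  q1P : forall i f2,
    dif1 (resG i) (q1 i f2) *: e0 i = co i (dif2 resF f2) *: e0 i;
  q2P : forall i f3, dif2 (resG i) (q2 i f3) = q1 i (dif3 resF f3)
}.

Variable D : trimming_data.

Local Notation F := (resF D).
Local Notation G := (resG D).
Local Notation d1 := (dif1 F).
Local Notation d3 := (dif3 F).
Local Notation m1 i := (dif1 (G i)).
Local Notation m2 i := (dif2 (G i)).
Local Notation m3 i := (dif3 (G i)).

Definition d2' (f2 : M2 F) : F1' D := pr D (dif2 F f2).

Definition T1 : vectType R := (F1' D * dsum (fun i => M1 (G i)))%type.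
Definition T2 : vectType R := (M2 F * dsum (fun i => M2 (G i)))%type.
Definition T3 : vectType R := (M3 F * dsum (fun i => M3 (G i)))%type.

Definition ell1 (x : T1) : R^o :=
  d1 (inc D x.1) - \sum_i m1 i (x.2 i) * d1 (e0 D i).

Definition ell2 (x : T2) : T1 :=
  (d2' x.1, dsum_of (fun i => - q1 D i x.1 + m2 i (x.2 i))).

Definition ell3 (x : T3) : T2 :=
  (d3 x.1, dsum_of (fun i => q2 D i x.1 + m3 i (x.2 i))).

Fact ell1_linear : linear ell1.
Proof.
move=> a x y; rewrite /ell1 /= !linearP scalerBr addrACA -opprD; congr (_ - _).
rewrite scaler_sumr -big_split /=; apply: eq_bigr => i _.
by rewrite dsumDE dsumZE linearP mulrDl -[RHS]/(_ * (_ * _) + _) mulrA.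
Qed.

Fact ell2_linear : linear ell2.
Proof.
move=> a x y; rewrite /ell2 /d2' /=; congr pair; first by rewrite !linearP.
apply/dsumP=> i; rewrite !(dsumDE, dsumZE, dsumE) !linearP /=.
by rewrite scalerDr addrACA.
Qed.

Fact ell3_linear : linear ell3.
Proof.
move=> a x y; rewrite /ell3 /=; congr pair; first by rewrite !linearP.
apply/dsumP=> i; rewrite !(dsumDE, dsumZE, dsumE) !linearP /=.
by rewrite scalerDr addrACA.
Qed.

HB.instance Definition _ := GRing.isLinear.Build R T1 R^o _ ell1 ell1_linear.
HB.instance Definition _ := GRing.isLinear.Build R T2 T1 _ ell2 ell2_linear.
HB.instance Definition _ := GRing.isLinear.Build R T3 T2 _ ell3 ell3_linear.

Definition trimming_complex : free3 R := Free3 ell1 ell2 ell3.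

Definition inF1 (f : F1' D) : T1 := (f, 0).
Definition inF2 (f : M2 F) : T2 := (f, 0).
Definition inG1 i (g : M1 (G i)) : T1 := (0, dinj g).
Definition inG2 i (g : M2 (G i)) : T2 := (0, dinj g).
Definition inG3 i (g : M3 (G i)) : T3 := (0, dinj g).

(* For [z] in [T1], [T2] or [T3], [z.1] is the component in [F] and [z.2 k] the
   component in [G k]; so for [x] in [G i], [(inGn x).2 k] is [delta_ik x]. *)
Record trimming_product (mulF : product (term F))
    (mulG : forall i, product (term (G i)))
    (mulT : product (term trimming_complex)) : Prop := TrimmingProduct {
  tp_f1f1 : forall f f' : F1' D,
    let z := mul11 mulT (inF1 f) (inF1 f') in
    let ff' := mul11 mulF (inc D f) (inc D f') in
    z.1 = ff' /\ forall k, m2 k (z.2 k) = q1 D k ff';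
  tp_f1g1 : forall f i (g : M1 (G i)),
    let z := mul11 mulT (inF1 f) (inG1 g) in
    let ef := mul11 mulF (e0 D i) (inc D f) in
    z.1 = m1 i g *: ef /\
    forall k, m2 k (z.2 k) = d1 (inc D f) *: (inG1 g).2 k + m1 i g *: q1 D k ef;
  tp_g1g1 : forall i (g g' : M1 (G i)),
    mul11 mulT (inG1 g) (inG1 g')
    = inG2 (- d1 (e0 D i) *: mul11 (mulG i) g g');
  tp_g1g1' : forall (i j : 'I_t) (g : M1 (G i)) (h : M1 (G j)), (i < j)%N ->
    let z := mul11 mulT (inG1 g) (inG1 h) in
    let ee := mul11 mulF (e0 D i) (e0 D j) in
    z.1 = (m1 i g * m1 j h) *: ee /\
    forall k, m2 k (z.2 k)
              = (m1 i g * m1 j h) *: q1 D k ee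
                + (m1 j h * d1 (e0 D j)) *: (inG1 g).2 k
                - (m1 i g * d1 (e0 D i)) *: (inG1 h).2 k;
  tp_f1f2 : forall (f : F1' D) (f2 : M2 F),
    let z := mul12 mulT (inF1 f) (inF2 f2) in
    let ff2 := mul12 mulF (inc D f) f2 in
    z.1 = ff2 /\
    forall k, m3 k (z.2 k)
              = - ((mul11 mulT (inF1 f) (inF1 (d2' f2))).2 k
                   - \sum_j (mul11 mulT (inF1 f) (inG1 (q1 D j f2))).2 k
                   + q2 D k ff2);
  tp_f1g2 : forall (f : F1' D) i (g2 : M2 (G i)),
    let z := mul12 mulT (inF1 f) (inG2 g2) in
    z.1 = 0 /\
    forall k, m3 k (z.2 k)
              = d1 (inc D f) *: (inG2 g2).2 k
                - (mul11 mulT (inF1 f) (inG1 (m2 i g2))).2 k;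
  tp_g1g2 : forall i (g : M1 (G i)) (g2 : M2 (G i)),
    mul12 mulT (inG1 g) (inG2 g2)
    = inG3 (- d1 (e0 D i) *: mul12 (mulG i) g g2);
  tp_g1g2' : forall i j (g : M1 (G i)) (h2 : M2 (G j)), i != j ->
    let z := mul12 mulT (inG1 g) (inG2 h2) in
    z.1 = 0 /\
    forall k, m3 k (z.2 k)
              = - (mul11 mulT (inG1 g) (inG1 (m2 j h2))).2 k
                - (m1 i g * d1 (e0 D i)) *: (inG2 h2).2 k;
  tp_g1f2 : forall i (g : M1 (G i)) (f2 : M2 F),
    let z := mul12 mulT (inG1 g) (inF2 f2) in
    let ef2 := mul12 mulF (e0 D i) f2 in
    z.1 = - m1 i g *: ef2 /\
    forall k, m3 k (z.2 k)
              = - d1 (e0 D i) *: (inG2 (mul11 (mulG i) g (q1 D i f2))).2 k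
                + (mul11 mulT (inF1 (d2' f2)) (inG1 g)).2 k
                + \sum_(l | l != i)
                    (mul11 mulT (inG1 g) (inG1 (q1 D l f2))).2 k
                + m1 i g *: q2 D k ef2
}.

End Trimming.

(** * The graded setting *)

Section Graded.
Variable R : comNzRingType.

(* [phi] identifies [R] with a standard graded polynomial ring; [z] is a degree
   in [int], and the homogeneous part of negative degree is [0]. *)
Definition poly_homog (k : fieldType) (n : nat)
    (phi : {rmorphism {mpoly k[n]} -> R}) (z : int) (r : R) :=
  exists2 p : {mpoly k[n]},
    phi p = r & if z is Posz m then p \is m.-homog else p == 0.

Variable hdeg : int -> R -> Prop.

(* [gr z] is the homogeneous part of degree [z] of a finitely generated graded
   free module [M], with homogeneous basis [e] in degrees [a]. *)
Definition free_grading (M : vectType R) (gr : int -> M -> Prop) :=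
  exists r (e : 'I_r -> M) (a : 'I_r -> int),
    bijective (fun c : {ffun 'I_r -> R} => \sum_i c i *: e i) /\
    forall z x, gr z x <->
      exists2 c : {ffun 'I_r -> R},
        x = \sum_i c i *: e i & forall i, hdeg (z - a i) (c i).

Definition grading (F : nat -> vectType R) := forall n, int -> F n -> Prop.

Definition graded_complex (C : free3 R) (gr : grading (term C)) :=
  [/\ forall n, free_grading (gr n),
      forall z r, gr 0%N z r <-> hdeg z r
    & forall n z x, gr n.+1 z x -> gr n z (diff C n x)].

Definition graded_product (F : nat -> vectType R) (gr : grading F)
    (mul : product F) :=
  forall i j n (H : (i + j)%N = n) z w x y,
    gr i z x -> gr j w y -> gr n (z + w) (mul i j n H x y).

(* [s i] is the degree of [e0 i], so that [gr_dec] reads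
   [F_1 = F_1' (+) R(- s 1) (+) ... (+) R(- s t)].  Homogeneity of the ideals
   follows from that of [dif1].  Since [q1 i], [q2 i] lower degrees by [s i],
   [trimming_grading] below shifts [G i] by [s i]. *)
Record graded_trimming t (D : trimming_data R t)
    (grF1' : int -> F1' D -> Prop) (grF : grading (term (resF D)))
    (grG : forall i, grading (term (resG D i))) (s : 'I_t -> int) : Prop :=
  GradedTrimming {
    gr_F : graded_complex grF;
    gr_G : forall i, graded_complex (grG i);
    gr_F1' : free_grading grF1';
    gr_dec : forall z (x : M1 (resF D)),
      grF 1%N z x <->
      grF1' z (pr D x) /\ forall i, hdeg (z - s i) (co D i x);
    gr_q1 : forall i z (x : M2 (resF D)),
      grF 2%N z x -> grG i 1%N (z - s i) (q1 D i x);
    gr_q2 : forall i z (x : M3 (resF D)),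
      grF 3%N z x -> grG i 2%N (z - s i) (q2 D i x)
  }.

Definition trimming_grading t (D : trimming_data R t)
    (grF1' : int -> F1' D -> Prop) (grF : grading (term (resF D)))
    (grG : forall i, grading (term (resG D i))) (s : 'I_t -> int) :
    grading (term (trimming_complex D)) :=
  fun n => match n return int -> term (trimming_complex D) n -> Prop with
  | 0 => hdeg
  | 1 => fun z x => grF1' z x.1 /\ forall i, grG i 1%N (z - s i) (x.2 i)
  | 2 => fun z x => grF 2%N z x.1 /\ forall i, grG i 2%N (z - s i) (x.2 i)
  | 3 => fun z x => grF 3%N z x.1 /\ forall i, grG i 3%N (z - s i) (x.2 i)
  | _ => fun _ _ => True
  end.

End Graded.

(* Main.v *)
Require Import Defs.
From HB Require Import structures.
From mathcomp Require Import all_boot all_order all_algebra.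
From mathcomp Require Import mpoly.

Set Implicit Arguments.
Unset Strict Implicit.
Unset Printing Implicit Defensive.

Import GRing.Theory.
Local Open Scope ring_scope.

(** Let [T] be the iterated trimming complex.  A product on [T] amounts to an
    alternating bilinear map [T_1 x T_1 -> T_2] that satisfies the Leibniz
    rule.  Indeed [T] is exact in degrees two and three ([ell2_exact],
    [ell3_inj]), so the Leibniz rule for [x * y] with [x] in [T_1] and [y] in
    [T_2] asks for a preimage of a cycle under the injective [ell3]; it
    determines [x * y], and associativity and the remaining Leibniz rules hold
    since both sides have the same image under [ell3].  This is the argument of
    Buchsbaum and Eisenbud, [dg_of_alternating].

    The map [chain1], [f + sum_i g_i |-> f - sum_i m_1(g_i) e_0^i], continued by
    the projections in degrees two and three, is a chain map from [T] to [F].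
    Let the [F]-component of [x * y] be [chain1 x * chain1 y].  The Leibniz rule
    then prescribes the image under [m_2^k] of the component [(x * y)_k] in
    [G^k_2], and the summand [- d_1(e_0^k) x_k * y_k] of that component accounts
    for the products inside [G^k_1].  What is left, [defect k], is alternating,
    consists of cycles of [G^k] ([m1_defect]), and vanishes on all
    [G^i_1 x G^i_1] ([defect_inG1]).  Lifting it on pairs of basis vectors, with
    lift [0] wherever it vanishes ([alternating_lift]), gives a product that is
    the prescribed one on [G^i_1 x G^i_1].  The formulas for all other products
    are the Leibniz rule read componentwise ([trimming_product_of_dg]).

    Homogeneous lifts of homogeneous cycles exist ([homog_preimage]), so the
    product can be chosen homogeneous when the data are.  The construction is
    made once, for gradings by projections [ring_grading], of which both the
    grading of a polynomial ring and the trivial grading, where all elements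
    are homogeneous of all degrees, are instances. *)

(** * Bilinear maps *)

Section Bilinear.
Variable R : comNzRingType.

Definition linear_of (U V : lmodType R) (f : U -> V) (lf : linear f) :
    {linear U -> V} :=
  HB.pack f (GRing.isLinear.Build R U V _ f lf).

Record bilinear_map (U V W : lmodType R) (b : U -> V -> W) : Prop :=
  BilinearMap {
    bilinear_l : forall v, linear (fun u => b u v);
    bilinear_r : forall u, linear (b u)
  }.

Definition alternating (U W : lmodType R) (b : U -> U -> W) :=
  forall u, b u u = 0.

Section Theory.
Variables (U V W : lmodType R) (b : U -> V -> W) (bb : bilinear_map b).
Let bl v := linear_of (bilinear_l bb v).
Let br u := linear_of (bilinear_r bb u).

Lemma bilin0l v : b 0 v = 0. Proof. exact: (raddf0 (bl v)). Qed.
Lemma bilin0r u : b u 0 = 0. Proof. exact: (raddf0 (br u)). Qed.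
Lemma bilinDl v : {morph b^~ v : u u' / u + u'}.
Proof. exact: (raddfD (bl v)). Qed.
Lemma bilinDr u : {morph b u : v v' / v + v'}.
Proof. exact: (raddfD (br u)). Qed.
Lemma bilinNl v : {morph b^~ v : u / - u}.
Proof. exact: (raddfN (bl v)). Qed.
Lemma bilinNr u : {morph b u : v / - v}.
Proof. exact: (raddfN (br u)). Qed.
Lemma bilinZl a u v : b (a *: u) v = a *: b u v.
Proof. exact: (linearZ_LR (bl v)). Qed.
Lemma bilinZr a u v : b u (a *: v) = a *: b u v.
Proof. exact: (linearZ_LR (br u)). Qed.
Lemma bilin_suml (I : Type) (r : seq I) (P : pred I) (f : I -> U) v :
  b (\sum_(i <- r | P i) f i) v = \sum_(i <- r | P i) b (f i) v.
Proof. exact: (raddf_sum (bl v)). Qed.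
Lemma bilin_sumr (I : Type) (r : seq I) (P : pred I) (f : I -> V) u :
  b u (\sum_(i <- r | P i) f i) = \sum_(i <- r | P i) b u (f i).
Proof. exact: (raddf_sum (br u)). Qed.
End Theory.

Lemma bilinear_map_flip (U V W : lmodType R) (b : U -> V -> W) :
  bilinear_map b -> bilinear_map (fun v u => b u v).
Proof. by move=> [hl hr]; split. Qed.

Lemma bilinear_map0 (U V W : lmodType R) :
  bilinear_map (fun (_ : U) (_ : V) => 0 : W).
Proof. by split=> u a v w; rewrite scaler0 addr0. Qed.

Lemma bilinear_map_scale (V : lmodType R) :
  bilinear_map (fun (a : R^o) (v : V) => (a : R) *: v).
Proof.
split=> [v a b c|b a v w]; first by rewrite scalerDl -scalerA.
by rewrite scalerDr !scalerA mulrC.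
Qed.

Lemma bilinear_mapD (U V W : lmodType R) (b c : U -> V -> W) :
  bilinear_map b -> bilinear_map c -> bilinear_map (fun u v => b u v + c u v).
Proof.
by move=> bb bc; split=> u a v w; rewrite 1?(bilinear_l bb) 1?(bilinear_l bc)
  1?(bilinear_r bb) 1?(bilinear_r bc) scalerDr addrACA.
Qed.

Lemma bilinear_map_comp (U V W U' V' W' : lmodType R) (b : U -> V -> W)
    (f : {linear U' -> U}) (g : {linear V' -> V}) (h : {linear W -> W'}) :
  bilinear_map b -> bilinear_map (fun u v => h (b (f u) (g v))).
Proof.
by move=> bb; split=> u a v w; rewrite linearP /=
  1?(bilinear_l bb) 1?(bilinear_r bb) linearP.
Qed.

Lemma alternating_anti (U W : lmodType R) (b : U -> U -> W) :
  bilinear_map b -> alternating b -> forall u v, b u v = - b v u.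
Proof.
move=> bb ab u v; apply/eqP; rewrite -addr_eq0; apply/eqP.
have := ab (u + v); rewrite (bilinDl bb) !(bilinDr bb) !ab.
by rewrite add0r addr0.
Qed.

(** The terms at [(i, j)] and [(j, i)] cancel; comparing the sum with its own
    opposite would leave a factor two. *)
Lemma sum_alternating (V : zmodType) (I : finType) (A : I -> I -> V) :
  (forall i, A i i = 0) -> (forall i j, A i j = - A j i) ->
  \sum_i \sum_j A i j = 0.
Proof.
move=> A0 AN; rewrite pair_big /=.
pose lt (p : I * I) := (enum_rank p.1 < enum_rank p.2)%N.
rewrite (bigID lt) /= [X in _ + X](bigID (fun p => p.1 == p.2)) /=.
rewrite [X in _ + (X + _)]big1 => [|[i j] /andP[_ /eqP /= ->]]; last exact: A0.
rewrite add0r [X in _ + X](reindex_inj (h := fun p => (p.2, p.1))) /=;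
  last by move=> [i j] [i' j'] [-> ->].
rewrite [X in _ + X](eq_bigl lt) => [|[i j]]; last first.
  rewrite /lt /= -leqNgt ltn_neqAle andbC; congr (~~ _ && _).
  by apply/eqP/eqP=> [->|/val_inj/enum_rank_inj].
rewrite -big_split big1 //= => -[i j] _ /=.
by rewrite AN addNr.
Qed.

End Bilinear.

(** * Graded rings and graded free modules *)

Section Graded.
Variable R : comNzRingType.

(** The grading enters through the projections [comp z] onto the homogeneous
    parts.  The identity is such a projection when all elements count as
    homogeneous of all degrees, so that ungraded statements are special cases
    of graded ones. *)
Record ring_grading (hdeg : int -> R -> Prop) (comp : int -> R -> R) : Prop :=
  RingGrading {
    hdegE : forall z r, hdeg z r <-> comp z r = r;
    comp_add : forall z, {morph comp z : r s / r + s};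
    comp_idem : forall z r, comp z (comp z r) = comp z r;
    comp_one : comp 0 1 = 1;
    comp_mul : forall z w r s, hdeg w s -> comp (z + w) (r * s) = comp z r * s
  }.

Variables (hdeg : int -> R -> Prop) (comp : int -> R -> R).
Hypothesis gR : ring_grading hdeg comp.

Lemma comp0 z : comp z 0 = 0.
Proof. by apply: (@addrI _ (comp z 0)); rewrite -(comp_add gR) !addr0. Qed.

Lemma comp_sum z (I : Type) (r : seq I) (P : pred I) (f : I -> R) :
  comp z (\sum_(i <- r | P i) f i) = \sum_(i <- r | P i) comp z (f i).
Proof. exact: (big_morph _ (comp_add gR z) (comp0 z)). Qed.

Lemma hdeg_comp z r : hdeg z (comp z r).
Proof. by apply/(hdegE gR); rewrite (comp_idem gR). Qed.

Lemma hdeg0 z : hdeg z 0. Proof. by apply/(hdegE gR); rewrite comp0. Qed.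
Lemma hdeg1 : hdeg 0 1. Proof. by apply/(hdegE gR); rewrite (comp_one gR). Qed.

Lemma hdegD z r s : hdeg z r -> hdeg z s -> hdeg z (r + s).
Proof.
move=> /(hdegE gR) hr /(hdegE gR) hs.
by apply/(hdegE gR); rewrite (comp_add gR) hr hs.
Qed.

Lemma hdegM z w r s : hdeg z r -> hdeg w s -> hdeg (z + w) (r * s).
Proof.
by move=> /(hdegE gR) hr hs; apply/(hdegE gR); rewrite (comp_mul gR) ?hr.
Qed.

Lemma hdegN z r : hdeg z r -> hdeg z (- r).
Proof.
move=> /(hdegE gR) hr; apply/(hdegE gR)/(@addrI _ (comp z r)).
by rewrite -(comp_add gR) subrr comp0 hr subrr.
Qed.

(** The coordinate forms [co] are part of the data since homogeneity of an
    element is a condition on its coordinates. *)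
Record homog_basis (I : finType) (M : lmodType R) (gr : int -> M -> Prop)
    (e : I -> M) (deg : I -> int) (co : I -> M -> R^o) : Prop := HomogBasis {
  hb_linear : forall i, linear (co i);
  hb_sum : forall x, x = \sum_i co i x *: e i;
  hb_dual : forall i j, co i (e j) = (i == j)%:R;
  hb_grade : forall z x, gr z x <-> forall i, hdeg (z - deg i) (co i x)
}.

Definition homog_free (M : lmodType R) (gr : int -> M -> Prop) :=
  exists (I : finType) (e : I -> M) (deg : I -> int) (co : I -> M -> R^o),
    homog_basis gr e deg co.

Section Theory.
Variables (I : finType) (M : lmodType R) (gr : int -> M -> Prop).
Variables (e : I -> M) (deg : I -> int) (co : I -> M -> R^o).
Hypothesis hb : homog_basis gr e deg co.
Let col i := linear_of (hb_linear hb i).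

Lemma hb_coD i x y : co i (x + y) = co i x + co i y.
Proof. exact: (raddfD (col i)). Qed.
Lemma hb_coN i x : co i (- x) = - co i x.
Proof. exact: (raddfN (col i)). Qed.
Lemma hb_coZ i a x : co i (a *: x) = a * co i x.
Proof. exact: (linearZ_LR (col i)). Qed.
Lemma hb_co0 i : co i 0 = 0.
Proof. exact: (raddf0 (col i)). Qed.
Lemma hb_co_sum i (J : Type) (r : seq J) (P : pred J) (f : J -> M) :
  co i (\sum_(j <- r | P j) f j) = \sum_(j <- r | P j) co i (f j).
Proof. exact: (raddf_sum (col i)). Qed.

Lemma hb_deg i : gr (deg i) (e i).
Proof.
apply/(hb_grade hb) => j; rewrite (hb_dual hb).
by have [->|_] := eqVneq j i; [rewrite subrr; exact: hdeg1|exact: hdeg0].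
Qed.

Lemma homog_basis_free : homog_free gr.
Proof. by exists I, e, deg, co. Qed.

Lemma homog_basis_shift s :
  homog_basis (fun z => gr (z - s)) e (fun i => deg i + s) co.
Proof.
case: hb => h1 h2 h3 h4; split=> // z x; rewrite h4.
by split=> h i; have := h i; rewrite opprD addrA addrAC.
Qed.

End Theory.

Section Closure.
Variables (M : lmodType R) (gr : int -> M -> Prop).
Hypothesis fr : homog_free gr.

Lemma grade0 z : gr z 0.
Proof.
have [I [e [deg [co hb]]]] := fr; apply/(hb_grade hb) => i.
by rewrite (hb_co0 hb); exact: hdeg0.
Qed.

Lemma gradeD z x y : gr z x -> gr z y -> gr z (x + y).
Proof.
have [I [e [deg [co hb]]]] := fr; rewrite !(hb_grade hb) => hx hy i.
by rewrite (hb_coD hb); exact: hdegD.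
Qed.

Lemma gradeN z x : gr z x -> gr z (- x).
Proof.
have [I [e [deg [co hb]]]] := fr; rewrite !(hb_grade hb) => hx i.
by rewrite (hb_coN hb); exact: hdegN.
Qed.

Lemma gradeB z x y : gr z x -> gr z y -> gr z (x - y).
Proof. by move=> hx hy; apply: gradeD => //; exact: gradeN. Qed.

Lemma gradeZ z w a x : hdeg z a -> gr w x -> gr (z + w) (a *: x).
Proof.
have [I [e [deg [co hb]]]] := fr; rewrite !(hb_grade hb) => ha hx i.
by rewrite (hb_coZ hb) -addrA; exact: hdegM.
Qed.

Lemma grade_sum z (I : Type) (r : seq I) (P : pred I) (f : I -> M) :
  (forall i, P i -> gr z (f i)) -> gr z (\sum_(i <- r | P i) f i).
Proof. by move=> h; elim/big_ind: _ => //; [exact: grade0|exact: gradeD]. Qed.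

End Closure.

(** The coordinates of a preimage may be replaced by their homogeneous parts,
    since projecting onto a homogeneous part commutes with multiplication by
    the homogeneous entries of the matrix of [g]. *)
Lemma homog_preimage (M N : lmodType R) (grM : int -> M -> Prop)
    (grN : int -> N -> Prop) (g : {linear M -> N}) z (x : M) :
  homog_free grM -> homog_free grN ->
  (forall w u, grM w u -> grN w (g u)) ->
  grN z (g x) -> exists2 y, grM z y & g y = g x.
Proof.
move=> [I [e [deg [co hb]]]] frN gg; have [J [e' [deg' [co' hb']]]] := frN.
move=> hgx; have hx := proj1 (hb_grade hb' _ _) hgx.
exists (\sum_i comp (z - deg i) (co i x) *: e i).
  apply/(hb_grade hb) => j; rewrite (hb_co_sum hb) (bigD1 j) //=.
  rewrite big1 ?addr0 => [|i ij]; rewrite (hb_coZ hb) (hb_dual hb).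
    by rewrite eqxx mulr1; exact: hdeg_comp.
  by rewrite eq_sym (negPf ij) mulr0.
rewrite [LHS](hb_sum hb') [RHS](hb_sum hb'); apply: eq_bigr => j _.
congr (_ *: _); have := hx j => /(hdegE gR) <-.
rewrite [in RHS](hb_sum hb x) !raddf_sum /= !(hb_co_sum hb') comp_sum.
apply: eq_bigr => i _; rewrite !linearZ !(hb_coZ hb').
have /(hb_grade hb')/(_ j) h := gg _ _ (hb_deg hb i).
rewrite -(comp_mul gR (z - deg i) (co i x) h).
by rewrite addrA subrK.
Qed.

(** * Lifting bilinear maps *)

Section Lift.
Variables (I J : finType) (M N P Q : lmodType R).
Variables (grM : int -> M -> Prop) (eM : I -> M) (degM : I -> int).
Variables (coM : I -> M -> R^o) (hM : homog_basis grM eM degM coM).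
Variables (grN : int -> N -> Prop) (eN : J -> N) (degN : J -> int).
Variables (coN : J -> N -> R^o) (hN : homog_basis grN eN degN coN).
Variables (grP : int -> P -> Prop) (frP : homog_free grP).

Definition bilinear_ext (L : I -> J -> P) u v : P :=
  \sum_i \sum_j (coM i u * coN j v) *: L i j.

Lemma bilinear_ext_bilinear L : bilinear_map (bilinear_ext L).
Proof.
split=> [v a u u'|u a v v']; rewrite /bilinear_ext scaler_sumr -big_split;
  apply: eq_bigr => i _; rewrite scaler_sumr -big_split; apply: eq_bigr => j _;
  rewrite /= scalerA -scalerDl; congr (_ *: _).
- by rewrite (hb_linear hM) mulrDl -[a *: _]/(a * _) mulrA.
- by rewrite (hb_linear hN) mulrDr -[a *: _]/(a * _) mulrCA.
Qed.

Lemma bilinear_ext_graded L :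
  (forall i j, grP (degM i + degN j) (L i j)) ->
  forall z w u v, grM z u -> grN w v -> grP (z + w) (bilinear_ext L u v).
Proof.
move=> hL z w u v /(hb_grade hM) hu /(hb_grade hN) hv.
apply: (grade_sum frP) => i _; apply: (grade_sum frP) => j _.
rewrite (_ : z + w = (z - degM i) + (w - degN j) + (degM i + degN j)).
  by apply: (gradeZ frP) => //; exact: hdegM.
by rewrite addrACA !subrK.
Qed.

Lemma bilinear_ext_lift L (g : {linear P -> Q}) (c : M -> N -> Q) :
  bilinear_map c -> (forall i j, g (L i j) = c (eM i) (eN j)) ->
  forall u v, g (bilinear_ext L u v) = c u v.
Proof.
move=> bc hL u v; rewrite [in RHS](hb_sum hM u) (bilin_suml bc) raddf_sum.
apply: eq_bigr => i _; rewrite [in RHS](hb_sum hN v) (bilin_sumr bc) raddf_sum.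
apply: eq_bigr => j _; rewrite (bilinZl bc) (bilinZr bc) [LHS]linearZ_LR hL.
by rewrite scalerA.
Qed.

End Lift.

Lemma bilinear_lift (M N P Q : lmodType R) (grM : int -> M -> Prop)
    (grN : int -> N -> Prop) (grP : int -> P -> Prop) (grQ : int -> Q -> Prop)
    (g : {linear P -> Q}) (c : M -> N -> Q) :
  homog_free grM -> homog_free grN -> homog_free grP -> homog_free grQ ->
  (forall z p, grP z p -> grQ z (g p)) ->
  bilinear_map c -> (forall u v, exists p, g p = c u v) ->
  (forall z w u v, grM z u -> grN w v -> grQ (z + w) (c u v)) ->
  exists b : M -> N -> P,
    [/\ bilinear_map b, forall u v, g (b u v) = c u v
      & forall z w u v, grM z u -> grN w v -> grP (z + w) (b u v)].
Proof.
move=> [I [eM [degM [coM hM]]]] [J [eN [degN [coN hN]]]] frP frQ gg bc cP cgr.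
have /fin_all_exists[L hL] i : exists L : J -> P, forall j,
    g (L j) = c (eM i) (eN j) /\ grP (degM i + degN j) (L j).
  suff /fin_all_exists[L hL] j : exists p,
      g p = c (eM i) (eN j) /\ grP (degM i + degN j) p by exists L.
  have [p hp] := cP (eM i) (eN j).
  have [|p' hp' E] := @homog_preimage _ _ _ _ g (degM i + degN j) p frP frQ gg.
    by rewrite hp; apply: cgr; [exact: (hb_deg hM)|exact: (hb_deg hN)].
  by exists p'; rewrite E.
exists (bilinear_ext coM coN L); split.
- exact: (bilinear_ext_bilinear hM hN).
- by apply: (bilinear_ext_lift hM hN bc) => i j; have [] := hL i j.
- by apply: (bilinear_ext_graded hM hN frP) => i j; have [] := hL i j.
Qed.

(** A lift chosen at the pairs of distinct basis vectors in one order extends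
    to an alternating map.  Choosing the lift [0] whenever possible makes the
    result vanish on every pair of blocks of the basis on which [c] does. *)
Lemma alternating_lift (I : finType) (M P Q : lmodType R)
    (grM : int -> M -> Prop) (grP : int -> P -> Prop) (grQ : int -> Q -> Prop)
    (e : I -> M) (deg : I -> int) (co : I -> M -> R^o)
    (g : {linear P -> Q}) (c : M -> M -> Q) :
  homog_basis grM e deg co -> homog_free grP -> homog_free grQ ->
  (forall z p, grP z p -> grQ z (g p)) ->
  bilinear_map c -> alternating c -> (forall u v, exists p, g p = c u v) ->
  (forall z w u v, grM z u -> grM w v -> grQ (z + w) (c u v)) ->
  exists b : M -> M -> P,
    [/\ bilinear_map b, alternating b, forall u v, g (b u v) = c u v,
        forall z w u v, grM z u -> grM w v -> grP (z + w) (b u v)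
      & forall u v,
          (forall i j, [\/ co i u = 0, co j v = 0 | c (e i) (e j) = 0]) ->
          b u v = 0].
Proof.
move=> hM frP frQ gg bc ac cP cgr.
have /fin_all_exists[L hL] i : exists L : I -> P, forall j,
    [/\ g (L j) = c (e i) (e j), grP (deg i + deg j) (L j)
      & c (e i) (e j) = 0 -> L j = 0].
  suff /fin_all_exists[L hL] j : exists p, [/\ g p = c (e i) (e j),
      grP (deg i + deg j) p & c (e i) (e j) = 0 -> p = 0] by exists L.
  have [c0|cN0] := eqVneq (c (e i) (e j)) 0.
    by exists 0; rewrite raddf0 c0; split=> //; exact: (grade0 frP).
  have [p hp] := cP (e i) (e j).
  have [|p' hp' E] := @homog_preimage _ _ _ _ g (deg i + deg j) p frP frQ gg.
    by rewrite hp; apply: cgr; exact: (hb_deg hM).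
  by exists p'; rewrite E hp; split=> // /eqP; rewrite (negPf cN0).
pose lt (i j : I) := (enum_rank i < enum_rank j)%N.
pose A i j := if lt i j then L i j else if lt j i then - L j i else 0.
have ltN (i j : I) : lt i j -> lt j i = false.
  by rewrite /lt => h; rewrite ltnNge (ltnW h).
have ltE i j : lt i j = false -> lt j i = false -> i = j.
  rewrite /lt => /negbT; rewrite -leqNgt => h1 /negbT; rewrite -leqNgt => h2.
  by apply/enum_rank_inj/val_inj/anti_leq; rewrite h1 h2.
have cN := alternating_anti bc ac.
have hA i j : [/\ g (A i j) = c (e i) (e j), grP (deg i + deg j) (A i j)
      & c (e i) (e j) = 0 -> A i j = 0].
  rewrite /A; case: ifP => [_|lij]; first exact: hL.
  case: ifP => [_|lji]; last first.
    by rewrite (ltE _ _ lij lji) ac raddf0; split=> //; exact: (grade0 frP).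
  have [h1 h2 h3] := hL j i; split; first by rewrite (raddfN g) /= h1 -cN.
    by rewrite addrC; exact: (gradeN frP).
  by move=> c0; rewrite h3 ?oppr0 // cN c0 oppr0.
have AN i j : A i j = - A j i.
  rewrite /A; case: (boolP (lt i j)) => [/ltN->|_]; first by rewrite opprK.
  by case: ifP; rewrite ?oppr0.
exists (bilinear_ext co co A); split.
- exact: (bilinear_ext_bilinear hM hM).
- move=> u; apply: sum_alternating => [i|i j].
    by rewrite /A /lt ltnn scaler0.
  by rewrite mulrC AN scalerN.
- by apply: (bilinear_ext_lift hM hM bc) => i j; have [] := hA i j.
- by apply: (bilinear_ext_graded hM hM frP) => i j; have [] := hA i j.
- move=> u v h; apply: big1 => i _; apply: big1 => j _.
  have [_ _ A0] := hA i j.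
  by case: (h i j) => [->|->|/A0->]; rewrite ?mul0r ?mulr0 ?scale0r ?scaler0.
Qed.

End Graded.

(** * Direct sums of graded free modules *)

Section DirectSumGrading.
Variable R : comNzRingType.

Section Injection.
Variables (t : nat) (V : 'I_t -> vectType R).

Lemma dinjE i (x : V i) : dinj x i = x.
Proof. by rewrite dsumE dfwith_in. Qed.

Lemma dinj_neq i k (x : V i) : i != k -> dinj x k = 0.
Proof. by move=> ik; rewrite dsumE dfwith_out. Qed.

Lemma dsum_sumE (I : Type) (r : seq I) (P : pred I) (f : I -> dsum V) k :
  (\sum_(i <- r | P i) f i) k = \sum_(i <- r | P i) f i k.
Proof.
exact: (big_morph (fun u : dsum V => u k) (fun u v => dsumDE u v k)
  (dsum0E V k)).
Qed.

Lemma sum_dinj (u : forall i, V i) k : \sum_i dinj (u i) k = u k.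
Proof.
rewrite (bigD1 k) //= dinjE big1 ?addr0 // => i ik.
by rewrite dinj_neq.
Qed.
End Injection.

Lemma dinj_comp (t : nat) (V W : 'I_t -> vectType R)
    (f : forall k, V k -> W k) :
  (forall k, f k 0 = 0) ->
  forall i (x : V i) k, f k (dinj x k) = dinj (f i x) k.
Proof.
move=> f0 i x k; have [<-|ik] := eqVneq i k; first by rewrite !dinjE.
by rewrite !dinj_neq.
Qed.

Variable hdeg : int -> R -> Prop.

Lemma free_grading_basis (M : vectType R) (gr : int -> M -> Prop) :
  free_grading hdeg gr ->
  exists r (e : 'I_r -> M) (deg : 'I_r -> int) (co : 'I_r -> M -> R^o),
    homog_basis hdeg gr e deg co.
Proof.
move=> [r [e [deg [[h hK Kh] hgr]]]]; exists r, e, deg, (fun i x => h x i).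
have sumE (c : 'I_r -> R) i : h (\sum_j c j *: e j) i = c i.
  rewrite -(ffunE c i); congr (fun_of_fin _ i).
  by rewrite -[RHS]hK; congr h; apply: eq_bigr => j _; rewrite ffunE.
split=> [i a x y|x|i j|z x].
- rewrite -{1}(Kh x) -{1}(Kh y) scaler_sumr -big_split /=.
  under eq_bigr => j _ do rewrite scalerA -scalerDl.
  by rewrite sumE.
- exact/esym/Kh.
- rewrite -(sumE (fun i => (i == j)%:R)); congr (h _ i).
  rewrite (bigD1 j) //= eqxx scale1r big1 ?addr0 // => k /negPf ->.
  by rewrite scale0r.
- rewrite hgr; split=> [[c ->] hc i|hx]; last by exists (h x); rewrite ?Kh.
  by rewrite hK.
Qed.

Definition prod_co (I J : finType) (M N : lmodType R) (coM : I -> M -> R^o)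
    (coN : J -> N -> R^o) (i : I + J) (x : M * N) : R^o :=
  match i with inl i => coM i x.1 | inr j => coN j x.2 end.

Lemma prod_basis (I J : finType) (M N : lmodType R) grM grN eM eN degM degN
    (coM : I -> M -> R^o) (coN : J -> N -> R^o) :
  homog_basis hdeg grM eM degM coM -> homog_basis hdeg grN eN degN coN ->
  homog_basis hdeg (fun z (x : (M * N)%type) => grM z x.1 /\ grN z x.2)
    (fun i => match i with inl i => (eM i, 0) | inr j => (0, eN j) end)
    (fun i => match i with inl i => degM i | inr j => degN j end)
    (prod_co coM coN).
Proof.
move=> hM hN; split=> [[i|j] a x y|x|[i|j] [i'|j']|z x] /=.
- exact: (hb_linear hM).
- exact: (hb_linear hN).
- rewrite big_sumType /=; apply: injective_projections => /=.
    rewrite !(raddf_sum fst) /= [X in _ + X]big1 ?addr0 => [|j _].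
      exact: (hb_sum hM).
    by rewrite scaler0.
  rewrite !(raddf_sum snd) /= big1 ?add0r => [|j _].
    exact: (hb_sum hN).
  by rewrite scaler0.
- exact: (hb_dual hM).
- exact: (hb_co0 hM).
- exact: (hb_co0 hN).
- exact: (hb_dual hN).
- rewrite (hb_grade hM) (hb_grade hN).
  split=> [[h1 h2] [i|j]|h]; [exact: h1|exact: h2|split=> i].
    exact: (h (inl i)).
  exact: (h (inr i)).
Qed.

Lemma prod_free (M N : lmodType R) (grM : int -> M -> Prop)
    (grN : int -> N -> Prop) :
  homog_free hdeg grM -> homog_free hdeg grN ->
  homog_free hdeg (fun z (x : (M * N)%type) => grM z x.1 /\ grN z x.2).
Proof.
move=> [I [eM [degM [coM hM]]]] [J [eN [degN [coN hN]]]].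
exact: homog_basis_free (prod_basis hM hN).
Qed.

Section Dsum.
Variables (t : nat) (V : 'I_t -> vectType R) (I : 'I_t -> finType).

Definition dsum_co (co : forall k, I k -> V k -> R^o) (p : {k & I k})
    (x : dsum V) : R^o :=
  co (tag p) (tagged p) (x (tag p)).

Lemma dsum_basis gr (e : forall k, I k -> V k) deg co :
  (forall k, homog_basis hdeg (gr k) (e k) (deg k) (co k)) ->
  homog_basis hdeg (fun z (x : dsum V) => forall k, gr k z (x k))
    (fun p : {k & I k} => dinj (e (tag p) (tagged p)))
    (fun p => deg (tag p) (tagged p)) (dsum_co co).
Proof.
move=> hb; split=> [[k i] a x y|x|[k i] [l j]|z x].
- by rewrite /dsum_co /= dsumDE dsumZE (hb_linear (hb k)).
- apply/dsumP => k; rewrite dsum_sumE.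
  pose F l i := (co l i (x l) *: dinj (e l i)) k.
  transitivity (\sum_l \sum_i F l i); last by rewrite sig_big_dep.
  rewrite (bigD1 k) //= [X in _ + X]big1 ?addr0 => [|l lk].
    rewrite [LHS](hb_sum (hb k)); apply: eq_bigr => i _.
    by rewrite /F dsumZE dinjE.
  by apply: big1 => i _; rewrite /F dsumZE dinj_neq // scaler0.
- rewrite /dsum_co /=; have [E|lk] := eqVneq l k; last first.
    rewrite dinj_neq // (hb_co0 (hb k)); case: eqP => // E.
    by have /= kl := congr1 tag E; rewrite kl eqxx in lk.
  by case: k / E i => i; rewrite dinjE (hb_dual (hb l)) eq_Tagged.
- split=> [h [k i]|h k]; first exact: (proj1 (hb_grade (hb k) _ _) (h k)).
  by apply/(hb_grade (hb k)) => i; exact: (h (existT _ k i)).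
Qed.

End Dsum.

Lemma dsum_free (t : nat) (V : 'I_t -> vectType R)
    (gr : forall k, int -> V k -> Prop) :
  (forall k, homog_free hdeg (gr k)) ->
  homog_free hdeg (fun z (x : dsum V) => forall k, gr k z (x k)).
Proof.
move=> /fin_all_exists[I /fin_all_exists[e /fin_all_exists[deg
  /fin_all_exists[co hb]]]].
exact: homog_basis_free (dsum_basis hb).
Qed.

Lemma ring_basis :
  homog_basis hdeg (hdeg : int -> R^o -> Prop)
    (fun _ : 'I_1 => 1 : R^o) (fun=> 0) (fun=> id).
Proof.
split=> // [x|i j|z x].
- by rewrite big_ord1 -[_ *: _]/(_ * _) mulr1.
- by rewrite !ord1.
- by rewrite subr0; split=> [|/(_ ord0)].
Qed.

Lemma zero_basis : homog_basis hdeg (fun (_ : int) (_ : 'rV[R]_0) => True)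
  (of_void _) (of_void int) (of_void _).
Proof.
split=> [[]|x|[]|z x]; first by rewrite big1 ?[x]thinmx0 // => -[].
by split=> // _ [].
Qed.

End DirectSumGrading.

(** * Multiplications on exact complexes of length three *)

Section Length3.
Variables (R : comNzRingType) (C : free3 R).
Local Notation d1 := (dif1 C).
Local Notation d2 := (dif2 C).
Local Notation d3 := (dif3 C).

Lemma term_gt3_eq n (x y : term C n) : (3 < n)%N -> x = y.
Proof.
by case: n x y => [|[|[|[|n]]]] // x y _; rewrite [x]thinmx0 [y]thinmx0.
Qed.

Section Product.
Variables (b11 : M1 C -> M1 C -> M2 C) (b12 : M1 C -> M2 C -> M3 C).

Definition mul_low i j : term C i -> term C j -> term C (i + j) :=
  match i, j return term C i -> term C j -> term C (i + j) with
  | 0, _ => fun a y => (a : R) *: y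
  | 1, 0 | 2, 0 | 3, 0 => fun x a => (a : R) *: x
  | 1, 1 => b11
  | 1, 2 => b12
  | 2, 1 => fun y x => b12 x y
  | _, _ => fun _ _ => 0
  end.

Definition product3 : product (term C) :=
  fun i j n H x y => eq_rect (i + j)%N (term C) (mul_low x y) n H.

Lemma product3E i j (H : (i + j = i + j)%N) x y :
  product3 H x y = mul_low (i := i) (j := j) x y.
Proof. by rewrite /product3 (eq_irrelevance H erefl). Qed.

Lemma product3_0l n (H : (0 + n = n)%N) (a : R^o) (x : term C n) :
  product3 (i := 0%N) H a x = (a : R) *: x.
Proof. exact: (@product3E 0%N n). Qed.

Lemma product3_0r n (H : (n + 0 = n)%N) (a : R^o) (x : term C n) :
  product3 (j := 0%N) H x a = (a : R) *: x.
Proof.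
case: n H x => [|[|[|[|n]]]] H x; last exact: term_gt3_eq.
- by rewrite (@product3E 0%N 0%N) [LHS]mulrC.
- exact: (@product3E 1%N 0%N).
- exact: (@product3E 2%N 0%N).
- exact: (@product3E 3%N 0%N).
Qed.

Hypotheses (bb11 : bilinear_map b11) (bb12 : bilinear_map b12).

Lemma mul_low_bilinear i j : bilinear_map (@mul_low i j).
Proof.
have scaler (V : lmodType R) := bilinear_map_flip (bilinear_map_scale V).
case: i => [|i]; first exact: bilinear_map_scale.
case: i => [|[|[|i]]]; case: j => [|[|[|j]]]; try exact: bilinear_map0;
  first [exact: scaler|done|exact: bilinear_map_flip].
Qed.

Lemma product3_bilinear i j n (H : (i + j = n)%N) :
  bilinear_map (fun (x : term C i) (y : term C j) => product3 H x y).
Proof. by case: n / H; exact: mul_low_bilinear. Qed.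

Hypotheses (ab11 : alternating b11).
Hypotheses (d1K : forall y, d1 (d2 y) = 0) (d2K : forall z, d2 (d3 z) = 0).
Hypothesis d3_inj : injective d3.
Hypothesis leibniz11 : forall x y,
  d2 (b11 x y) = (d1 x : R) *: y - (d1 y : R) *: x.
Hypothesis leibniz12 : forall x y,
  d3 (b12 x y) = (d1 x : R) *: y - b11 x (d2 y).

Let b11N := alternating_anti bb11 ab11.

(** Both sides have the same image under the injective [d3]. *)
Lemma mul_low_assoc (x y z : M1 C) : b12 z (b11 x y) = b12 x (b11 y z).
Proof.
apply: d3_inj; rewrite !leibniz12 !leibniz11 !(bilinDr bb11) !(bilinNr bb11).
rewrite !(bilinZr bb11) (b11N z x) (b11N z y) !scalerN !opprB !opprK.
by rewrite addrA addrC.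
Qed.

Lemma product3_assoc i j k a b n (Ha : (i + j = a)%N) (Hak : (a + k = n)%N)
    (Hb : (j + k = b)%N) (Hib : (i + b = n)%N)
    (x : term C i) (y : term C j) (z : term C k) :
  product3 Hak (product3 Ha x y) z = product3 Hib x (product3 Hb y z).
Proof.
have [n3|n3] := ltnP 3 n; first exact: (term_gt3_eq _ _ n3).
case: i => [|i] in Ha Hib x *.
  have E : j = a := Ha; case: a / E in Ha Hak *.
  have E : b = n := Hib; case: n / E in Hak Hib n3 *.
  rewrite !product3_0l (bilinZl (product3_bilinear Hak)).
  by rewrite (eq_irrelevance Hak Hb).
case: j => [|j] in Ha Hb y *.
  have E : i.+1 = a by rewrite -Ha addn0.
  case: a / E in Ha Hak *.
  have E : k = b := Hb; case: b / E in Hb Hib *.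
  rewrite product3_0l product3_0r (bilinZl (product3_bilinear Hak)).
  by rewrite (bilinZr (product3_bilinear Hib)) (eq_irrelevance Hak Hib).
case: k => [|k] in Hak Hb z *.
  have E : a = n by rewrite -Hak addn0.
  case: n / E in Hak Hib n3 *.
  have E : j.+1 = b by rewrite -Hb addn0.
  case: b / E in Hb Hib *.
  rewrite !product3_0r (bilinZr (product3_bilinear Hib)).
  by rewrite (eq_irrelevance Ha Hib).
case: a / Ha in Hak *; case: b / Hb in Hib *; case: n / Hak in Hib n3 *.
case: i => [|i] in x Hib n3 *; last by rewrite !addnS !addSn in n3.
case: j => [|j] in y Hib n3 *; last by rewrite !addnS !addSn in n3.
case: k => [|k] in z Hib n3 *; last by rewrite !addnS !addSn in n3.
rewrite (eq_irrelevance Hib erefl).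
exact: mul_low_assoc.
Qed.

Lemma product3_leibniz i j n (H : (i.+1 + j.+1 = n.+1)%N)
    (Hl : (i + j.+1 = n)%N) (Hr : (i.+1 + j = n)%N)
    (x : term C i.+1) (y : term C j.+1) :
  diff C n (product3 H x y) =
  product3 Hl (diff C i x) y + (-1) ^+ i.+1 *: product3 Hr x (diff C j y).
Proof.
have [n3|n3] := ltnP 3 n; first exact: (term_gt3_eq _ _ n3).
case: n / Hl in H Hr n3 *.
case: i => [|[|[|i]]] in H Hr n3 x *; last by rewrite !addnS !addSn in n3.
all: case: j => [|[|[|j]]] in H Hr n3 y *; try by rewrite !addnS ?addSn in n3.
all: rewrite (eq_irrelevance H erefl) (eq_irrelevance Hr erefl) /product3 /=.
all: rewrite -signr_odd /= ?expr0 ?expr1 ?scaleN1r ?scale1r.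
- exact: leibniz11.
- exact: leibniz12.
- apply: d3_inj; rewrite raddf0 raddfB /= linearZ_LR /=.
  rewrite leibniz12 d2K (bilin0r bb11) subr0.
  by rewrite subrr.
- by rewrite [LHS]leibniz12 (b11N y) opprK addrC.
- apply: d3_inj; rewrite raddf0 raddfD /=.
  rewrite [X in _ = X + _]leibniz12 [X in _ = _ + X]leibniz12 !d1K !scale0r.
  by rewrite !sub0r b11N opprK addrN.
- apply: d3_inj; rewrite raddf0 raddfB /= linearZ_LR /=.
  rewrite leibniz12 d2K (bilin0r bb11) subr0.
  by rewrite subrr.
Qed.

Lemma product3_comm i j n (H : (i + j = n)%N) (H' : (j + i = n)%N)
    (x : term C i) (y : term C j) :
  product3 H x y = (-1) ^+ (i * j) *: product3 H' y x.
Proof.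
have [n3|n3] := ltnP 3 n; first exact: (term_gt3_eq _ _ n3).
case: i => [|i] in x H H' *.
  have E : j = n := H; case: n / E in n3 H H' *.
  by rewrite product3_0l product3_0r mul0n expr0 scale1r.
case: j => [|j] in y H H' *.
  have E : i.+1 = n := H'; case: n / E in n3 H H' *.
  by rewrite product3_0l product3_0r muln0 expr0 scale1r.
case: n / H in n3 H' *.
case: i => [|[|i]] in x n3 H' *; last by rewrite !addnS !addSn in n3.
all: case: j => [|[|j]] in y n3 H' *; try by rewrite !addnS ?addSn in n3.
all: rewrite (eq_irrelevance H' erefl) -signr_odd /=.
all: rewrite ?expr0 ?expr1 ?scaleN1r ?scale1r //.
Qed.

Lemma product3_dg : dg_algebra3 product3.
Proof.
split.
- by case=> [|[|[|n]]] x /=; [exact: d1K|exact: d2K|exact: raddf0|].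
- by move=> i j n H y; exact: (bilinear_l (product3_bilinear H)).
- by move=> i j n H x; exact: (bilinear_r (product3_bilinear H)).
- by move=> n H x; rewrite product3_0l scale1r.
- by move=> n H x; rewrite product3_0r scale1r.
- exact: product3_assoc.
- exact: product3_leibniz.
- move=> j n H Hr x y; have E : j = n := Hr; case: n / E in H Hr *.
  by rewrite !product3_0l linearZ.
- move=> i n H Hl x y; have E : i = n by rewrite -Hl addn0.
  by case: n / E in H Hl *; rewrite !product3_0r linearZ.
- exact: product3_comm.
- move=> i n H x oi; case: i => [|[|i]] in H x oi * => //.
    by case: n / H; exact: ab11.
  by apply: term_gt3_eq; rewrite -H !addnS !addSn; case: i oi {x H}.
Qed.

End Product.
End Length3.

Section ExactProduct.
Variables (R : comNzRingType) (C : free3 R).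
Local Notation d1 := (dif1 C).
Local Notation d2 := (dif2 C).
Local Notation d3 := (dif3 C).

(** Exactness provides the product of degrees one and two, as a lift along the
    injective [d3] of the cycle that the Leibniz rule prescribes. *)
Theorem dg_of_alternating (hdeg : int -> R -> Prop) (comp : int -> R -> R)
    (gr : grading (term C)) (b11 : M1 C -> M1 C -> M2 C) :
  ring_grading hdeg comp ->
  (forall n, homog_free hdeg (gr n)) ->
  (forall z r, gr 0%N z r <-> hdeg z r) ->
  (forall n z x, gr n.+1 z x -> gr n z (diff C n x)) ->
  (forall y, d1 (d2 y) = 0) ->
  (forall y, d2 y = 0 <-> exists z, d3 z = y) -> injective d3 ->
  bilinear_map b11 -> alternating b11 ->
  (forall x y, d2 (b11 x y) = (d1 x : R) *: y - (d1 y : R) *: x) ->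
  (forall z w x y, gr 1%N z x -> gr 1%N w y -> gr 2%N (z + w) (b11 x y)) ->
  exists mul : product (term C),
    [/\ dg_algebra3 mul, forall x y, mul11 mul x y = b11 x y
      & graded_product gr mul].
Proof.
move=> gR fr gr0 grd d1K ex2 inj bb ab L11 gb.
pose c x y : M2 C := (d1 x : R) *: y - b11 x (d2 y).
have bc : bilinear_map c.
  apply: bilinear_mapD.
    exact: (bilinear_map_comp d1 idfun idfun (bilinear_map_scale _)).
  apply: (bilinear_map_comp idfun d2 -%R bb).
have c0 x y : exists p, d3 p = c x y.
  apply/ex2; rewrite raddfB /= linearZ_LR L11 d1K scale0r subr0 subrr //.
have gc z w x y : gr 1%N z x -> gr 2%N w y -> gr 2%N (z + w) (c x y).
  move=> hx hy; apply: (gradeB gR (fr 2%N)).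
    by apply: (gradeZ gR (fr 2%N)) => //; apply/gr0; exact: (grd 0%N).
  by apply: gb => //; exact: (grd 1%N).
have [b12 [bb12 L12 gb12]] := bilinear_lift gR (fr 1%N) (fr 2%N) (fr 3%N)
  (fr 2%N) (grd 2%N) bc c0 gc.
have d2K z : d2 (d3 z) = 0 by apply/ex2; exists z.
exists (product3 b11 b12); split=> //; first exact: product3_dg.
move=> i j n H z w x y.
have [n3|n3] := ltnP 3 n.
  move=> _ _; rewrite (term_gt3_eq (product3 _ _ _ _ _) 0 n3).
  exact: (grade0 gR).
case: i => [|i] in H x *.
  have E : j = n := H; case: n / E in H n3 *.
  by move=> /gr0 hx hy; rewrite product3_0l; exact: (gradeZ gR).
case: j => [|j] in H y *.
  have E : i.+1 = n by rewrite -H addn0.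
  case: n / E in H n3 *.
  by move=> hx /gr0 hy; rewrite product3_0r addrC; exact: (gradeZ gR).
case: n / H in n3 *.
case: i => [|[|i]] in x n3 *; last by rewrite !addnS !addSn in n3.
all: case: j => [|[|j]] in y n3 *; try by rewrite !addnS ?addSn in n3.
- exact: gb.
- exact: gb12.
- by rewrite addrC => hx hy; exact: gb12.
Qed.

End ExactProduct.

Section DGLength3.
Variables (R : comNzRingType) (C : free3 R) (mul : product (term C)).
Hypothesis dg : dg_algebra3 mul.

Lemma dg3_mul0l n (H : (0 + n = n)%N) (a : R^o) (x : term C n) :
  mul (i := 0%N) H a x = (a : R) *: x.
Proof.
rewrite -{1}[a]mulr1 -[a * 1]/(a *: (1 : R^o)).
have := linearZ_LR (linear_of (dg_linearl dg H x)) (a : R) (1 : R^o).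
by move=> /= ->; rewrite (dg_mul1l dg).
Qed.

Lemma dg3_mul0r n (H : (n + 0 = n)%N) (a : R^o) (x : term C n) :
  mul (j := 0%N) H x a = (a : R) *: x.
Proof. by rewrite (dg_comm dg H (add0n n)) muln0 expr0 scale1r dg3_mul0l. Qed.

Lemma dg3_bilinear11 : bilinear_map (mul11 mul).
Proof.
split=> u; first exact: (@dg_linearl _ _ _ _ _ dg 1%N 1%N 2%N erefl u).
exact: (@dg_linearr _ _ _ _ _ dg 1%N 1%N 2%N erefl u).
Qed.

Lemma dg3_bilinear12 : bilinear_map (mul12 mul).
Proof.
split=> u; first exact: (@dg_linearl _ _ _ _ _ dg 1%N 2%N 3%N erefl u).
exact: (@dg_linearr _ _ _ _ _ dg 1%N 2%N 3%N erefl u).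
Qed.

Lemma dg3_alternating11 : alternating (mul11 mul).
Proof. by move=> x; exact: (dg_sqr dg (i := 1%N) (n := 2%N) erefl x erefl). Qed.

Lemma dg3_leibniz11 x y : dif2 C (mul11 mul x y) =
  (dif1 C x : R) *: y - (dif1 C y : R) *: x.
Proof.
have := dg_leibniz dg (i := 0%N) (j := 0%N) (n := 1%N) erefl erefl erefl x y.
by rewrite dg3_mul0l dg3_mul0r expr1 scaleN1r.
Qed.

Lemma dg3_leibniz12 x y : dif3 C (mul12 mul x y) =
  (dif1 C x : R) *: y - mul11 mul x (dif2 C y).
Proof.
have := dg_leibniz dg (i := 0%N) (j := 1%N) (n := 2%N) erefl erefl erefl x y.
by rewrite dg3_mul0l expr1 scaleN1r.
Qed.

End DGLength3.

(** * The iterated trimming complex *)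

Section TrimmingComplex.
Variables (R : comNzRingType) (t : nat) (D : trimming_data R t).
Local Notation F := (resF D).
Local Notation G := (resG D).
Local Notation T := (trimming_complex D).
Local Notation d1 := (dif1 F).
Local Notation d2 := (dif2 F).
Local Notation d3 := (dif3 F).
Local Notation m1 i := (dif1 (G i)).
Local Notation m2 i := (dif2 (G i)).
Local Notation m3 i := (dif3 (G i)).

(** Degree one of a chain map from [T] to [F] that is the identity in degree
    zero and the first projection in degrees two and three. *)
Definition chain1 (x : T1 D) : M1 F :=
  inc D x.1 - \sum_i (m1 i (x.2 i) : R) *: e0 D i.

Fact chain1_linear : linear chain1.
Proof.
move=> a x y; rewrite /chain1 /= linearP scalerBr addrACA -opprD; congr (_ - _).
rewrite scaler_sumr -big_split /=; apply: eq_bigr => i _.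
by rewrite dsumDE dsumZE linearP scalerDl -scalerA.
Qed.

HB.instance Definition _ :=
  GRing.isLinear.Build R (T1 D) (M1 F) _ chain1 chain1_linear.

Definition compG1 i (x : T1 D) : M1 (G i) := x.2 i.

Fact compG1_linear i : linear (compG1 i).
Proof. by move=> a x y; rewrite /compG1 /= dsumDE dsumZE. Qed.

HB.instance Definition _ i :=
  GRing.isLinear.Build R (T1 D) (M1 (G i)) _ (compG1 i) (compG1_linear i).

Lemma ell1E (x : T1 D) : ell1 x = d1 (chain1 x).
Proof.
rewrite /ell1 /chain1 raddfB /= (raddf_sum d1) /=.
by under [in RHS]eq_bigr => i _ do rewrite linearZ_LR.
Qed.

Lemma co_chain1 k x : co D k (chain1 x) = - m1 k (x.2 k).
Proof.
rewrite /chain1 raddfB /= (raddf_sum (co D k)) /= co_inc sub0r.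
rewrite (bigD1 k) //= linearZ_LR co_e0 eqxx -[_ *: _]/(_ * _) mulr1.
rewrite big1 ?addr0 // => i ik.
by rewrite linearZ_LR co_e0 eq_sym (negPf ik) scaler0.
Qed.

Lemma pr_chain1 x : pr D (chain1 x) = x.1.
Proof.
rewrite /chain1 raddfB /= (raddf_sum (pr D)) /= pr_inc big1 ?subr0 // => i _.
by rewrite linearZ_LR pr_e0 scaler0.
Qed.

Lemma m1_q1 i f2 : m1 i (q1 D i f2) = co D i (d2 f2).
Proof.
have := congr1 (co D i) (q1P i f2); rewrite !linearZ_LR co_e0 eqxx.
by rewrite -![_ *: _]/(_ * _) !mulr1.
Qed.

Lemma m1_m2 i g : m1 i (m2 i g) = 0.
Proof. by have [_ ex _ _] := resGP D i; apply/ex; exists g. Qed.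

Lemma m2_m3 i g : m2 i (m3 i g) = 0.
Proof. by have [_ _ ex _] := resGP D i; apply/ex; exists g. Qed.

Lemma d1_d2 f : d1 (d2 f) = 0.
Proof. by have [_ ex _ _] := resFP D; apply/ex; exists f. Qed.

Lemma d2_d3 f : d2 (d3 f) = 0.
Proof. by have [_ _ ex _] := resFP D; apply/ex; exists f. Qed.

Lemma chain1_ell2 (y : T2 D) : chain1 (ell2 y) = d2 y.1.
Proof.
rewrite /chain1 /ell2 /= [RHS]decF1 -sumrN; congr (_ + _).
apply: eq_bigr => i _; rewrite dsumE raddfD raddfN /= m1_q1 m1_m2 addr0.
by rewrite scaleNr opprK.
Qed.

Lemma ell1_ell2 (y : T2 D) : ell1 (ell2 y) = 0.
Proof. by rewrite ell1E chain1_ell2 d1_d2. Qed.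

Lemma ell2_exact (y : T2 D) : ell2 y = 0 <-> exists z, ell3 z = y.
Proof.
split=> [y0|[z <-]]; last first.
  rewrite /ell2 /ell3 /d2' /= d2_d3 raddf0; congr pair; apply/dsumP => i.
  by rewrite !dsumE raddfD /= m2_m3 addr0 q2P addNr.
have d2y : d2 y.1 = 0 by rewrite -chain1_ell2 y0 raddf0.
have [_ _ exF _] := resFP D; have [f ff] := proj1 (exF _) d2y.
have /fin_all_exists[g gg] i : exists g, m3 i g = y.2 i - q2 D i f.
  have [_ _ exG _] := resGP D i; apply/exG; rewrite raddfB /= q2P ff.
  have := congr1 (fun x : T1 D => x.2 i) y0.
  by rewrite /= dsumE dsum0E addrC.
exists (f, dsum_of g); rewrite /ell3 /= ff [RHS]surjective_pairing.
by congr pair; apply/dsumP => i; rewrite !dsumE gg addrC subrK.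
Qed.

Lemma ell3_inj : injective (@ell3 _ _ D).
Proof.
move=> [f g] [f' g'] /= [/(let: And4 _ _ _ h := resFP D in h) <- /dsumP E].
congr pair; apply/dsumP => i; have := E i; rewrite !dsumE /=.
by move=> /addrI; case: (resGP D i) => _ _ _; apply.
Qed.

Section Product.
Variables (mulF : product (term F)) (mulG : forall i, product (term (G i))).
Hypotheses (dgF : dg_algebra3 mulF) (dgG : forall i, dg_algebra3 (@mulG i)).
Let bF := dg3_bilinear11 dgF.

Lemma chain1_inF1 f : chain1 (inF1 f) = inc D f.
Proof.
rewrite /chain1 /= big1 ?subr0 // => i _.
by rewrite dsum0E raddf0 scale0r.
Qed.

Lemma chain1_inG1 i (g : M1 (G i)) :
  chain1 (inG1 g) = - ((m1 i g : R) *: e0 D i).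
Proof.
rewrite /chain1 /= raddf0 sub0r (bigD1 i) //= dinjE big1 ?addr0 // => k ik.
by rewrite dinj_neq 1?eq_sym // raddf0 scale0r.
Qed.

Lemma ell1_inG1 i (g : M1 (G i)) : ell1 (inG1 g) = - (m1 i g * d1 (e0 D i)).
Proof. by rewrite ell1E chain1_inG1 raddfN /= linearZ_LR. Qed.

Lemma ell2_inG2 i (g : M2 (G i)) : ell2 (inG2 g) = inG1 (m2 i g).
Proof.
rewrite /ell2 /inG1 /d2' /= !raddf0; congr pair; apply/dsumP => k.
rewrite dsumE raddf0 oppr0 add0r (dinj_comp (f := fun i => m2 i)) // => j.
by rewrite raddf0.
Qed.

Lemma ell2_inF2 f : ell2 (inF2 f) = inF1 (d2' f) - \sum_i inG1 (q1 D i f).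
Proof.
rewrite /ell2 /=; apply: injective_projections => /=.
  by rewrite (raddf_sum fst) /= big1 ?subr0.
rewrite (raddf_sum snd) /= sub0r; apply/dsumP => k.
by rewrite dsumE dsum0E raddf0 addr0 dsumNE dsum_sumE sum_dinj.
Qed.

Variable mulT : product (term T).
Hypothesis dgT : dg_algebra3 mulT.
Hypothesis mulT_F : forall x y,
  (mul11 mulT x y).1 = mul11 mulF (chain1 x) (chain1 y).
Hypothesis mulT_G : forall i (g g' : M1 (G i)),
  mul11 mulT (inG1 g) (inG1 g') = inG2 (- d1 (e0 D i) *: mul11 (@mulG i) g g').
Let bT := dg3_bilinear11 dgT.

Lemma mulT11_G x y k : m2 k ((mul11 mulT x y).2 k) =
  (ell1 x : R) *: y.2 k - (ell1 y : R) *: x.2 k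
  + q1 D k (mul11 mulF (chain1 x) (chain1 y)).
Proof.
have := congr1 (fun x : T1 D => x.2 k) (dg3_leibniz11 dgT x y).
rewrite /= dsumE mulT_F dsumDE dsumNE !dsumZE => <-.
by rewrite addrC addrA subrr add0r.
Qed.

Lemma mulT12_F x y : (mul12 mulT x y).1 = mul12 mulF (chain1 x) y.1.
Proof.
have [_ _ _ inj] := resFP D; apply: inj; rewrite (dg3_leibniz12 dgF).
have := congr1 fst (dg3_leibniz12 dgT x y).
by rewrite /= => ->; rewrite mulT_F chain1_ell2 ell1E.
Qed.

Lemma mulT12_G x y k : m3 k ((mul12 mulT x y).2 k) =
  (ell1 x : R) *: y.2 k - (mul11 mulT x (ell2 y)).2 k
  - q2 D k (mul12 mulF (chain1 x) y.1).
Proof.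
have := congr1 (fun x : T2 D => x.2 k) (dg3_leibniz12 dgT x y).
rewrite /= dsumE mulT12_F dsumDE dsumNE dsumZE => <-.
by rewrite addrC addrA addNr add0r.
Qed.

(** Given the two hypotheses on [mulT], every formula follows from [mulT11_G],
    [mulT12_F] and [mulT12_G], which are the Leibniz rule read in one
    component. *)
Theorem trimming_product_of_dg : trimming_product mulF mulG mulT.
Proof.
have aF := alternating_anti bF (dg3_alternating11 dgF).
have aT := alternating_anti bT (dg3_alternating11 dgT).
have bF12 := dg3_bilinear12 dgF.
split=> /=.
- move=> f f'; rewrite mulT_F !chain1_inF1; split=> // k.
  by rewrite mulT11_G !chain1_inF1 /= dsum0E !scaler0 subr0 add0r.
- move=> f i g; have E : mul11 mulF (chain1 (inF1 f)) (chain1 (inG1 g)) =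
      (m1 i g : R) *: mul11 mulF (e0 D i) (inc D f).
    by rewrite chain1_inF1 chain1_inG1 aF (bilinNl bF) opprK (bilinZl bF).
  rewrite mulT_F E; split=> // k.
  rewrite mulT11_G E ell1E chain1_inF1 /= dsum0E scaler0 subr0.
  by rewrite linearZ_LR.
- exact: mulT_G.
- move=> i j g h ij; have E : mul11 mulF (chain1 (inG1 g)) (chain1 (inG1 h)) =
      (m1 i g * m1 j h) *: mul11 mulF (e0 D i) (e0 D j).
    rewrite !chain1_inG1 (bilinNl bF) (bilinNr bF) opprK (bilinZl bF).
    by rewrite (bilinZr bF) scalerA.
  rewrite mulT_F E; split=> // k; rewrite mulT11_G E !ell1_inG1 /=.
  rewrite !scaleNr opprK (linearZ_LR (q1 D k)) /=.
  by rewrite addrC -[RHS]addrA; congr (_ + _); exact: addrC.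
- move=> f f2; rewrite mulT12_F chain1_inF1; split=> // k.
  rewrite mulT12_G chain1_inF1 /= dsum0E scaler0 sub0r -opprD.
  congr (- (_ + _)).
  rewrite ell2_inF2 (bilinDr bT) (bilinNr bT) (bilin_sumr bT) /= dsumDE dsumNE.
  by rewrite (raddf_sum snd) dsum_sumE.
- move=> f i g2; rewrite mulT12_F /= (bilin0r bF12); split=> // k.
  rewrite mulT12_G /= (bilin0r bF12) raddf0 subr0 ell1E chain1_inF1.
  by rewrite ell2_inG2.
- move=> i g g2; rewrite [LHS]surjective_pairing mulT12_F /= (bilin0r bF12).
  congr pair; apply/dsumP => k; have [_ _ _ inj] := resGP D k; apply: inj.
  rewrite mulT12_G /= (bilin0r bF12) raddf0 subr0 ell2_inG2 mulT_G /=.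
  rewrite ell1_inG1 (dinj_comp (f := fun i => m3 i)); last first.
    by move=> j; rewrite raddf0.
  have [<-|ik] := eqVneq i k; last by rewrite !dinj_neq // scaler0 subr0.
  rewrite !dinjE (linearZ_LR (m3 i)) /= (dg3_leibniz12 (dgG i)) /= scalerBr.
  by rewrite !scaleNr scalerA mulrC.
- move=> i j g h2 ij; rewrite mulT12_F /= (bilin0r bF12); split=> // k.
  rewrite mulT12_G /= (bilin0r bF12) raddf0 subr0 ell1_inG1 ell2_inG2.
  by rewrite scaleNr addrC.
- move=> i g f2; have E : mul12 mulF (chain1 (inG1 g)) f2 =
      - m1 i g *: mul12 mulF (e0 D i) f2.
    by rewrite chain1_inG1 (bilinNl bF12) (bilinZl bF12) scaleNr.
  rewrite mulT12_F E; split=> // k; rewrite mulT12_G E /= dsum0E scaler0 sub0r.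
  rewrite scaleNr raddfN /= linearZ_LR opprK; congr (_ + _).
  rewrite ell2_inF2 (bilinDr bT) (bilinNr bT) (bilin_sumr bT) /= dsumDE dsumNE.
  rewrite (raddf_sum snd) dsum_sumE opprB (bigD1 i) //= mulT_G /= aT.
  rewrite [in RHS]addrAC; congr (_ + _ + _).
    rewrite -(dinj_comp (f := fun _ u => - d1 (e0 D i) *: u)) // => j.
    exact: scaler0.
  by rewrite aT /= dsumNE opprK.
Qed.

End Product.

End TrimmingComplex.

(** * The product on the iterated trimming complex *)

Section Construction.
Variables (R : comNzRingType) (t : nat) (D : trimming_data R t).
Local Notation F := (resF D).
Local Notation G := (resG D).
Local Notation T := (trimming_complex D).
Local Notation d1 := (dif1 F).
Local Notation m1 i := (dif1 (G i)).
Local Notation m2 i := (dif2 (G i)).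
Variables (hdeg : int -> R -> Prop) (comp : int -> R -> R).
Hypothesis gR : ring_grading hdeg comp.
Variables (grF1' : int -> F1' D -> Prop) (grF : grading (term F)).
Variables (grG : forall i, grading (term (G i))) (s : 'I_t -> int).
Hypothesis gD : graded_trimming hdeg grF1' grF grG s.
Local Notation grT := (@trimming_grading R hdeg t D grF1' grF grG s).


Let frG k n : homog_free hdeg (@grG k n).
Proof.
have [/(_ n)/free_grading_basis[r [e [deg [co hb]]]] _ _] := gr_G gD k.
exact: homog_basis_free hb.
Qed.

Let frGs k n : homog_free hdeg (fun z => @grG k n (z - s k)).
Proof.
have [/(_ n)/free_grading_basis[r [e [deg [co hb]]]] _ _] := gr_G gD k.
exact: homog_basis_free (homog_basis_shift hb (s k)).
Qed.

Let frF n : homog_free hdeg (@grF n).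
Proof.
have [/(_ n)/free_grading_basis[r [e [deg [co hb]]]] _ _] := gr_F gD.
exact: homog_basis_free hb.
Qed.

Let grFd n z x : @grF n.+1 z x -> @grF n z (diff F n x).
Proof. by have [_ _] := gr_F gD; apply. Qed.

Let grGd k n z x : @grG k n.+1 z x -> @grG k n z (diff (G k) n x).
Proof. by have [_ _] := gr_G gD k; apply. Qed.

Let grF0 z r : @grF 0%N z r <-> hdeg z r.
Proof. by have [_ + _] := gr_F gD; apply. Qed.

Let grG0 k z r : @grG k 0%N z r <-> hdeg z r.
Proof. by have [_ + _] := gr_G gD k; apply. Qed.

Lemma trimming_grading_free n : homog_free hdeg (@grT n).
Proof.
case: n => [|[|[|[|n]]]]; first exact: homog_basis_free (ring_basis hdeg).
- have [r [e [deg [co hb]]]] := free_grading_basis (gr_F1' gD).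
  exact: prod_free (homog_basis_free hb) (dsum_free (fun k => frGs k 1)).
- exact: prod_free (frF 2) (dsum_free (fun k => frGs k 2)).
- exact: prod_free (frF 3) (dsum_free (fun k => frGs k 3)).
- exact: homog_basis_free (zero_basis hdeg).
Qed.

Lemma chain1_graded z (x : T1 D) : @grT 1%N z x -> @grF 1%N z (chain1 x).
Proof.
move=> [hx hg]; apply/(gr_dec gD); rewrite pr_chain1; split=> // i.
rewrite co_chain1; apply: (hdegN gR); apply/grG0.
exact: (@grGd i 0%N).
Qed.

Lemma ell1_graded z (x : T1 D) : @grT 1%N z x -> hdeg z (ell1 x).
Proof.
by move=> /chain1_graded h; rewrite ell1E; apply/grF0; exact: (@grFd 0%N).
Qed.

Lemma d1_e0_graded k : hdeg (s k) (d1 (e0 D k)).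
Proof.
apply/grF0; apply: (@grFd 0%N); apply/(gr_dec gD); rewrite pr_e0; split.
  have /free_grading_basis[r [e [deg [co hb]]]] := gr_F1' gD.
  exact: (grade0 gR (homog_basis_free hb)).
move=> i; rewrite co_e0; have [->|_] := eqVneq i k.
  by rewrite subrr; exact: (hdeg1 gR).
exact: (hdeg0 gR).
Qed.

Lemma trimming_diff_graded n z x : @grT n.+1 z x -> @grT n z (diff T n x).
Proof.
case: n x => [|[|[|n]]] x //.
- exact: ell1_graded.
- move=> [hx hg]; split=> [|i] /=.
    by have /(gr_dec gD)[] := @grFd 1%N _ _ hx.
  rewrite dsumE; apply: (gradeD gR (frG i 1)).
    by apply: (gradeN gR (frG i 1)); exact: (gr_q1 gD).
  exact: (@grGd i 1%N).
- move=> [hx hg]; split=> [|i] /=; first exact: (@grFd 2%N).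
  rewrite dsumE; apply: (gradeD gR (frG i 2)); first exact: (gr_q2 gD).
  exact: (@grGd i 2%N).
- by move=> _; exact: (grade0 gR (trimming_grading_free n.+3) z).
Qed.

Variables (mulF : product (term F)) (mulG : forall i, product (term (G i))).
Hypotheses (dgF : dg_algebra3 mulF) (dgG : forall i, dg_algebra3 (@mulG i)).
Hypothesis gmF : graded_product grF mulF.
Hypothesis gmG : forall i, graded_product (@grG i) (@mulG i).
Let bF := dg3_bilinear11 dgF.
Let bG k := dg3_bilinear11 (dgG k).

(** The first two summands are the image under [m2 k] that the Leibniz rule
    prescribes for the component of [x * y] in [G k]; the last one takes away
    the image of [- d1 (e0 k) * (x_k * y_k)]. *)
Definition defect k (x y : T1 D) : M1 (G k) :=
  q1 D k (mul11 mulF (chain1 x) (chain1 y))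
  + ((ell1 x : R) *: y.2 k - (ell1 y : R) *: x.2 k)
  + d1 (e0 D k) *: m2 k (mul11 (@mulG k) (x.2 k) (y.2 k)).

Lemma defect_bilinear k : bilinear_map (defect k).
Proof.
have bs : bilinear_map (fun x y : T1 D => (ell1 x : R) *: y.2 k).
  have := bilinear_map_comp (dif1 T) (@compG1 R t D k : {linear _ -> _}) idfun
    (bilinear_map_scale (M1 (G k))).
  exact.
pose ph := @chain1 R t D : {linear T1 D -> M1 F}.
apply: bilinear_mapD; first apply: bilinear_mapD.
- exact: (bilinear_map_comp ph ph (q1 D k) bF).
- apply: bilinear_mapD => //.
  exact: (bilinear_map_comp idfun idfun -%R (bilinear_map_flip bs)).
- pose f := ( *:%R (d1 (e0 D k)) \o m2 k).
  pose c := @compG1 R t D k : {linear T1 D -> M1 (G k)}.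
  exact: (bilinear_map_comp c c f (bG k)).
Qed.

Lemma defect_alternating k : alternating (defect k).
Proof.
move=> x; rewrite /defect (dg3_alternating11 dgF) (dg3_alternating11 (dgG k)).
by rewrite (raddf0 (q1 D k)) (raddf0 (m2 k)) scaler0 subrr !addr0.
Qed.

Lemma m1_defect k x y : m1 k (defect k x y) = 0.
Proof.
rewrite /defect 2!(raddfD (m1 k)) /= (linearZ_LR (m1 k)) /= m1_m2 scaler0.
rewrite addr0 m1_q1 (dg3_leibniz11 dgF) -!ell1E (raddfB (co D k)) /=.
rewrite !(linearZ_LR (co D k)) !co_chain1 (raddfB (m1 k)) /=.
rewrite !(linearZ_LR (m1 k)) !scalerN opprK.
by rewrite addrACA addNr subrr addr0.
Qed.

(** [chain1] maps [G i] to multiples of [e0 i], whose square is zero; the other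
    two summands cancel by the Leibniz rule in [G i] if [k] is [i], and vanish
    otherwise. *)
Lemma defect_inG1 k i (g h : M1 (G i)) : defect k (inG1 g) (inG1 h) = 0.
Proof.
rewrite /defect !chain1_inG1 (bilinNl bF) (bilinNr bF) (bilinZl bF).
rewrite (bilinZr bF) (dg3_alternating11 dgF) !scaler0 !oppr0.
rewrite (raddf0 (q1 D k)) add0r !ell1_inG1 /=.
have [<-|ik] := eqVneq i k; last first.
  by rewrite !dinj_neq // (bilin0l (bG k)) (raddf0 (m2 k)) !scaler0 subrr addr0.
rewrite !dinjE (dg3_leibniz11 (dgG i)) scalerBr !scalerA !scaleNr opprK.
by rewrite ![d1 _ * _]mulrC addrACA addNr subrr addr0.
Qed.

Let sk k u v : s k + ((u - s k) + (v - s k)) = u + v - s k.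
Proof. by rewrite addrA [s k + _]addrC subrK addrA. Qed.

Lemma defect_graded k z w x y : @grT 1%N z x -> @grT 1%N w y ->
  @grG k 1%N (z + w - s k) (defect k x y).
Proof.
move=> hx hy; have [_ hxG] := hx; have [_ hyG] := hy.
have ex := ell1_graded hx; have ey := ell1_graded hy.
apply: (gradeD gR (frG k 1)); first apply: (gradeD gR (frG k 1)).
- apply: (gr_q1 gD).
  exact: (@gmF 1%N 1%N 2%N erefl z w _ _ (chain1_graded hx) (chain1_graded hy)).
- apply: (gradeB gR (frG k 1)).
    by rewrite -addrA; exact: (gradeZ gR (frG k 1)).
  by rewrite [z + w]addrC -addrA; exact: (gradeZ gR (frG k 1)).
- rewrite -sk; apply: (gradeZ gR (frG k 1)); first exact: d1_e0_graded.
  apply: (@grGd k 1%N).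
  exact: (@gmG k 1%N 1%N 2%N erefl _ _ _ _ (hxG k) (hyG k)).
Qed.

(** The bases of [F1'] and of the [G i] together form a basis of [T1], and
    [defect k] is zero at two basis vectors that belong to the same [G i]. *)
Lemma defect_lift k : exists b : T1 D -> T1 D -> M2 (G k),
  [/\ bilinear_map b, alternating b,
      forall x y, m2 k (b x y) = defect k x y,
      forall z w x y, @grT 1%N z x -> @grT 1%N w y ->
        @grG k 2%N (z + w - s k) (b x y)
    & forall i (g h : M1 (G i)), b (inG1 g) (inG1 h) = 0].
Proof.
have [r1 [e1 [deg1 [co1 hb1]]]] := free_grading_basis (gr_F1' gD).
have hG i := let: And3 h _ _ := gr_G gD i in free_grading_basis (h 1%N).
have {hG} [r /fin_all_exists[e /fin_all_exists[deg /fin_all_exists[co hG]]]] :=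
  fin_all_exists hG.
have hbG := dsum_basis (fun i => homog_basis_shift (hG i) (s i)).
have hbT := prod_basis hb1 hbG.
have lift x y : exists p, m2 k p = defect k x y.
  by have [_ ex _ _] := resGP D k; apply/ex/m1_defect.
have [b [bb ab bL bg b0]] := alternating_lift gR hbT (frGs k 2) (frGs k 1)
  (fun z p => @grGd k 1%N (z - s k) p) (defect_bilinear k)
  (defect_alternating k) lift (@defect_graded k).
exists b; split=> // i g h; apply: b0 => -[p|[j p]] q.
  by apply: Or31; rewrite /= (hb_co0 hb1).
have [E|ij] := eqVneq i j; last first.
  by apply: Or31; rewrite /= /dsum_co /= dinj_neq // (hb_co0 (hG j)).
case: j / E in p *; case: q => [q|[j q]].
  by apply: Or32; rewrite /= (hb_co0 hb1).
have [E|ij] := eqVneq i j; last first.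
  by apply: Or32; rewrite /= /dsum_co /= dinj_neq // (hb_co0 (hG j)).
by case: j / E in q *; apply: Or33; exact: defect_inG1.
Qed.

Lemma trimming_dg : exists mulT : product (term T),
  [/\ dg_algebra3 mulT, trimming_product mulF mulG mulT
    & graded_product (@grT) mulT].
Proof.
have /fin_all_exists[b bP] := defect_lift.
pose b11 x y : T2 D := (mul11 mulF (chain1 x) (chain1 y),
  dsum_of (fun k =>
    - d1 (e0 D k) *: mul11 (@mulG k) (x.2 k) (y.2 k) + b k x y)).
have bb11 : bilinear_map b11.
  split=> u a v w; apply: injective_projections => /=.
  - by rewrite linearP (bilinear_l bF).
  - apply/dsumP => k; have [bb _ _ _ _] := bP k.
    rewrite !(dsumE, dsumDE, dsumZE) (bilinear_l (bG k)) (bilinear_l bb).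
    by rewrite !scalerDr addrACA !scalerA mulrC.
  - by rewrite linearP (bilinear_r bF).
  - apply/dsumP => k; have [bb _ _ _ _] := bP k.
    rewrite !(dsumE, dsumDE, dsumZE) (bilinear_r (bG k)) (bilinear_r bb).
    by rewrite !scalerDr addrACA !scalerA mulrC.
have ab11 : alternating b11.
  move=> x; rewrite /b11 (dg3_alternating11 dgF); congr pair.
  apply/dsumP => k; have [_ ab _ _ _] := bP k.
  by rewrite dsumE (dg3_alternating11 (dgG k)) ab scaler0 addr0 dsum0E.
have leib x y : ell2 (b11 x y) = (ell1 x : R) *: y - (ell1 y : R) *: x.
  apply: injective_projections => /=.
    rewrite /d2' (dg3_leibniz11 dgF) -!ell1E (raddfB (pr D)) /=.
    by rewrite !(linearZ_LR (pr D)) !pr_chain1.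
  apply/dsumP => k; have [_ _ bL _ _] := bP k.
  rewrite 2!dsumE (raddfD (m2 k)) /= (linearZ_LR (m2 k)) /= bL /defect.
  rewrite scaleNr dsumDE dsumNE !dsumZE addrCA addrA addrC !addrA.
  by rewrite addrK addrC !addrA addNr add0r.
have gb11 z w x y : @grT 1%N z x -> @grT 1%N w y -> @grT 2%N (z + w) (b11 x y).
  move=> hx hy; have [_ hxG] := hx; have [_ hyG] := hy; split=> [|k] /=.
    exact: (@gmF 1%N 1%N 2%N erefl z w _ _
      (chain1_graded hx) (chain1_graded hy)).
  have [_ _ _ bg _] := bP k; rewrite dsumE.
  apply: (gradeD gR (frG k 2)); last exact: bg.
  rewrite -sk; apply: (gradeZ gR (frG k 2)).
    exact: (hdegN gR (d1_e0_graded k)).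
  exact: (@gmG k 1%N 1%N 2%N erefl _ _ _ _ (hxG k) (hyG k)).
have [mulT [dgT mE gT]] := dg_of_alternating gR trimming_grading_free
  (fun z r => iff_refl _) trimming_diff_graded (@ell1_ell2 R t D)
  (@ell2_exact R t D) (@ell3_inj R t D) bb11 ab11 leib gb11.
exists mulT; split=> //; apply: trimming_product_of_dg => // [x y|i g h].
  by rewrite mE.
rewrite mE /b11 !chain1_inG1 (bilinNl bF) (bilinNr bF) (bilinZl bF).
rewrite (bilinZr bF) (dg3_alternating11 dgF) !scaler0 !oppr0; congr pair.
apply/dsumP => k; rewrite dsumE; have [_ _ _ _ ->] := bP k; rewrite addr0 /=.
have [<-|ik] := eqVneq i k; first by rewrite !dinjE.
by rewrite !dinj_neq // (bilin0l (bG k)) scaler0.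
Qed.

End Construction.

(** * The two gradings *)

Lemma trivial_ring_grading (R : comNzRingType) :
  ring_grading (fun (_ : int) (_ : R) => True) (fun _ r => r).
Proof. by split. Qed.

Section TrivialGrading.
Import VectorInternalTheory.

Lemma trivial_free_grading (R : comNzRingType) (M : vectType R) :
  free_grading (fun _ _ => True) (fun (_ : int) (_ : M) => True).
Proof.
pose e i : M := r2v (delta_mx 0 i).
have sumE (c : {ffun 'I_(dim M) -> R}) :
    \sum_i c i *: e i = r2v (\row_i c i).
  rewrite (row_sum_delta (\row_i c i)) linear_sum; apply: eq_bigr => i _.
  by rewrite linearZ_LR mxE.
exists (dim M), e, (fun=> 0); split; last first.
  move=> z x; split=> // _; exists [ffun i => v2r x 0 i] => //.
  rewrite sumE -[LHS]v2rK; congr r2v.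
  by apply/rowP => i; rewrite mxE ffunE.
exists (fun x => [ffun i => v2r x 0 i]) => [c|x].
  by apply/ffunP => i; rewrite ffunE sumE r2vK mxE.
rewrite sumE -[RHS]v2rK; congr r2v.
by apply/rowP => i; rewrite mxE ffunE.
Qed.

End TrivialGrading.

Section PolynomialGrading.
Variables (k : fieldType) (n : nat).

Lemma pihomogM_homog (p q : {mpoly k[n]}) e m : q \is e.-homog ->
  pihomog mdeg m (p * q) =
    if (e <= m)%N then pihomog mdeg (m - e) p * q else 0.
Proof.
move=> hq.
(* The extra [m.+1] puts [m - e] within the range of the sum below. *)
have le : (mmeasure mdeg p <= mmeasure mdeg p + m.+1)%N by exact: leq_addr.
rewrite {1}(pihomog_partitionE le) mulr_suml raddf_sum /=.
have term d : pihomog mdeg m (pihomog mdeg d p * q) =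
    if (d + e == m)%N then pihomog mdeg d p * q else 0.
  have h : pihomog mdeg d p * q \is (d + e).-homog.
    by apply: dhomogM => //; exact: pihomogP.
  by case: eqVneq => [<-|ne]; [exact: pihomog_dE|exact: pihomog_ne0 ne h].
under eq_bigr => d _ do rewrite term.
rewrite -big_mkcond /=; case: leqP => [em|me]; last first.
  by rewrite big1 // => d /eqP dm; rewrite -dm ltnNge leq_addl in me.
have lt : (m - e < mmeasure mdeg p + m.+1)%N.
  by rewrite (leq_ltn_trans (leq_subr e m)) // ltn_addl.
rewrite (big_pred1 (Ordinal lt)) // => d.
by rewrite -[RHS]val_eqE /= -[RHS](eqn_add2r e) subnK.
Qed.

Variables (R : comNzRingType) (phi : {rmorphism {mpoly k[n]} -> R}).
Hypothesis phi_bij : bijective phi.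

Lemma poly_ring_grading : exists comp, ring_grading (poly_homog phi) comp.
Proof.
have [psi phiK psiK] := phi_bij.
pose comp (z : int) r :=
  if z is Posz m then phi (pihomog mdeg m (psi r)) else 0.
have compE m p : comp (Posz m) (phi p) = phi (pihomog mdeg m p).
  by rewrite /= phiK.
exists comp; split.
- case=> m r; split.
  + by move=> [p <- hp]; rewrite compE pihomog_dE.
  + by move=> <-; exists (pihomog mdeg m (psi r)) => //; exact: pihomogP.
  + by move=> [p <- /eqP->]; rewrite raddf0.
  + by move=> <-; exists 0; rewrite ?raddf0.
- case=> m r s /=; last by rewrite addr0.
  rewrite -(psiK r) -(psiK s) -rmorphD !phiK pihomogD; exact: rmorphD.
- by case=> m r //=; rewrite phiK pihomog_id.
- by rewrite -(rmorph1 phi) compE pihomog_dE ?dhomog1.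
- move=> z [e|e] r s [q <-]; last first.
    move=> /eqP ->; rewrite !raddf0 !mulr0.
    by case: (z + Negz e) => // m; rewrite -(raddf0 phi) compE pihomog0.
  move=> hq; rewrite -(psiK r) -rmorphM; case: z => d.
    rewrite -PoszD compE (pihomogM_homog _ _ hq) leq_addl addnK compE.
    exact: rmorphM.
  rewrite mul0r; case E: (Negz d + Posz e) => [m|] //.
  rewrite compE (pihomogM_homog _ _ hq) ifF ?raddf0 //.
  apply/negbTE; rewrite -ltnNge -ltz_nat -E NegzE addrC.
  by rewrite Num.Theory.ltrBlDr Num.Theory.ltrDl.
Qed.

End PolynomialGrading.

Theorem theorem3p2 (R : comNzRingType) (t : nat) (D : trimming_data R t)
    (mulF : product (term (resF D)))
    (mulG : forall i : 'I_t, product (term (resG D i)))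
    (dgF : dg_algebra3 mulF) (dgG : forall i : 'I_t, dg_algebra3 (mulG i)) :
  (regular_local R ->
   exists mulT : product (term (trimming_complex D)),
     dg_algebra3 mulT /\ trimming_product mulF mulG mulT) /\
  (forall (k : fieldType) (n : nat) (phi : {rmorphism {mpoly k[n]} -> R})
     (grF1' : int -> F1' D -> Prop) (grF : grading (term (resF D)))
     (grG : forall i : 'I_t, grading (term (resG D i))) (s : 'I_t -> int),
   bijective phi ->
   graded_trimming (poly_homog phi) grF1' grF grG s ->
   graded_product grF mulF ->
   (forall i : 'I_t, graded_product (grG i) (mulG i)) ->
   exists mulT : product (term (trimming_complex D)),
     [/\ dg_algebra3 mulT, trimming_product mulF mulG mulT
       & graded_product (trimming_grading (poly_homog phi) grF1' grF grG s)
           mulT]).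
Proof.
split=> [_|k n phi grF1' grF grG s phi_bij gD gmF gmG]; last first.
  have [comp gR] := poly_ring_grading phi_bij.
  exact: (trimming_dg gR gD dgF dgG gmF gmG).
have gC (C : free3 R) : @graded_complex R (fun _ _ => True) C
    (fun n (_ : int) (_ : term C n) => True).
  by split=> // n; exact: trivial_free_grading.
have gD : graded_trimming (fun _ _ => True)
    (fun (_ : int) (_ : F1' D) => True) (fun n _ _ => True)
    (fun i n _ _ => True) (fun i : 'I_t => 0).
  by split=> //; exact: trivial_free_grading.
have [||mulT [dgT tpT _]] := trimming_dg (@trivial_ring_grading R) gD dgF dgG.
- by [].
- by [].
- by exists mulT.
Qed.
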